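(* Let $X_1,X_2,\ldots$ be i.i.d. real random variables with distribution function $F$, and suppose that there exist $\xi\in\mathbb{R}$ and sequences $a_n>0$ and $b_n$ such that $$\lim_{n\to\infty}\mathbb{P}\left[\frac{\max(X_1,\ldots,X_n)-b_n}{a_n}\le x\right]=G_\xi(x).$$ Let $k=k(n)$ and $k'=k'(n)$ be integers with $1<k'<k<n$, and let $\hat\xi_{k,n}$ be the estimator of $\xi$ defined as the root of the equation in $\theta$ $$\left\{\frac{\varphi_\theta(1/k')}{\varphi_\theta(1/k)}\right\}\frac{X_{n-k+1,n}-X_{n,n}}{X_{n-k'+1,n}-X_{n,n}}=1 .$$ If $k/k'\to c>1$, $k\to\infty$ and $k/n\to 0$ as $n\to\infty$, then $\hat\xi_{k,n}$ converges to $\xi$ in probability as $n\to\infty$.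
   Context: $G_\xi(x)=\exp[-(1+\xi x)_+^{-1/\xi}]$ if $\xi\neq0$ and $G_0(x)=\exp[-e^{-x}]$, where $y_+=\max(0,y)$. $X_{1,n}\le\cdots\le X_{n,n}$ denote $X_1,\ldots,X_n$ rearranged in ascending order. For $t\in\mathbb{R}$ and $x>0$, $\varphi_t(x)=\int_1^x u^{t-1}\,du$. The paper asserts (citing another work for the proof) that the equation defining $\hat\xi_{k,n}$ admits a unique solution, so that $\hat\xi_{k,n}$ is well defined. *)

(* Defs.v *)
From HB Require Import structures.
From mathcomp Require Import all_boot all_order all_algebra.
From mathcomp Require Import finmap.
From mathcomp Require Import all_classical all_reals all_analysis.
Set Implicit Arguments.
Unset Strict Implicit.
Unset Printing Implicit Defensive.
Import Order.TTheory GRing.Theory Num.Theory.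
Import numFieldNormedType.Exports.
Local Open Scope classical_set_scope.
Local Open Scope ring_scope.

(* Samples are indexed from 0: X_1, X_2, ... is X 0, X 1, ... *)

Section Probability.
Context d (T : measurableType d) (R : realType) (P : probability T R).

Definition independent_RVs (X : nat -> {RV P >-> R}) : Prop :=
  forall (J : {fset nat}) (A : nat -> set R), (forall i, measurable (A i)) ->
    P (\bigcap_(i in [set` J]) (X i @^-1` A i)) =
    (\prod_(i <- J) P (X i @^-1` A i))%E.

Definition iid_RVs (F : R -> R) (X : nat -> {RV P >-> R}) : Prop :=
  independent_RVs X /\ forall i x, cdf (X i) x = (F x)%:E.

Definition cvg_in_probability (Y : nat -> T -> R) (l : R) : Prop :=
  forall eps : R, 0 < eps ->
    P [set w | eps < `|Y n w - l|] @[n --> \oo] --> 0%E.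

End Probability.

Section Estimator.
Context (R : realType).
Implicit Types (x : nat -> R) (xi t theta u : R) (j k n : nat).

(* When 1 + xi y <= 0, the term (1 + xi y)_+^(-1/xi) is 0^(-1/xi), that is
   +oo if xi > 0 and 0 if xi < 0, so that G_xi(y) is 0 or 1 respectively.
   These values are spelled out because 0 `^ r = 0 for every r != 0. *)
Definition gev xi (y : R) : R :=
  if xi == 0 then expR (- expR (- y))
  else if 0 < 1 + xi * y then expR (- ((1 + xi * y) `^ (- xi^-1)))
  else if 0 < xi then 0 else 1.

(* Maximum of the first n terms; meaningful for n >= 1. *)
Definition sample_max x n : R := \big[Num.max/x 0%N]_(i < n) x i.

(* X_{j,n}, with 1 <= j <= n. *)
Definition order_stat x j n : R :=
  nth 0 (sort <=%R [seq x i | i <- iota 0 n]) j.-1.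

(* The oriented integral of u^(t-1) from 1 to y, for y > 0. *)
Definition phi t (y : R) : R :=
  if 1 <= y then \int[lebesgue_measure]_(u in `[1, y]) (u `^ (t - 1))
  else - \int[lebesgue_measure]_(u in `[y, 1]) (u `^ (t - 1)).

(* Division by zero yields 0, so there is no root when X_{n-k'+1,n} = X_{n,n}. *)
Definition xi_equation k (k' : nat) n x theta : Prop :=
  phi theta (k'%:R^-1) / phi theta (k%:R^-1) *
  ((order_stat x (n - k + 1) n - order_stat x n n) /
   (order_stat x (n - k' + 1) n - order_stat x n n)) = 1.

(* The root of the equation; when 1 < k' < k < n it is unique whenever it
   exists, and it fails to exist only if two of X_{n-k+1,n}, X_{n-k'+1,n} and
   X_{n,n} coincide. The arbitrary value theta0 is used in the latter case. *)
Definition xi_hat (theta0 : R) k (k' : nat) n x : R := xget theta0 (xi_equation k k' n x).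

End Estimator.

(* Main.v *)
(* Write B_t(s) for the integral of e^{tx} over [0, s], so that phi_t(y) is
   B_t(ln y). The defining equation of the estimator becomes
     (X_{n-k'+1,n} - X_{n-k+1,n}) / (X_{n,n} - X_{n-k'+1,n})
       = B_{-t}(ln (k/k')) / B_t(ln k'),
   whose right-hand side decreases strictly from +oo to 0 as t runs over R. So it
   suffices that, with probability tending to 1, the left-hand side lies between
   the values of the right-hand side at xi + eps and xi - eps.

   Let m = n / k'. Since n (1 - F(a_n B_xi(s) + b_n)) -> e^{-s}, Chebyshev's
   inequality for the number of exceedances shows that, in the scale
   (a_m, b_m), X_{n-k'+1,n} tends to 0 and X_{n-k+1,n} to - B_{-xi}(ln c). The
   maximum lies between b_{m 2^(j-J)} and b_{m 2^(j+J)}, where 2^j is about k' and J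
   is a large constant, and b_{m 2^i} - b_m is between a_m B_t(i ln 2) and
   a_m B_t'(i ln 2) whenever t < xi < t' and m is large. No case distinction on
   the sign of xi is needed, because B_t(L + C) <= (1 + g) B_t'(L) for t < t' and
   large L. *)

Require Import Defs.
From mathcomp Require Import all_boot all_order all_algebra.
From mathcomp Require Import finmap.
From mathcomp Require Import all_classical all_reals all_analysis.
From mathcomp Require Import measurable_realfun.
From mathcomp Require Import ring lra.
Set Implicit Arguments.
Unset Strict Implicit.
Unset Printing Implicit Defensive.
Import Order.TTheory GRing.Theory Num.Theory.
Import numFieldNormedType.Exports.
Local Open Scope classical_set_scope.
Local Open Scope ring_scope.

(** * The Box-Cox transform and the estimating equation *)

Section BoxCox.
Context {R : realType}.
Implicit Types (t s u : R).

(** The closed form of B_t(s), the integral of e^{tx} over [0, s]. *)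
Definition boxcox t s : R := if t == 0 then s else (expR (t * s) - 1) / t.

Lemma boxcoxE t s : 1 + t * boxcox t s = expR (t * s).
Proof.
rewrite /boxcox; have [->|t0] := eqVneq t 0; first by rewrite !mul0r expR0 addr0.
by rewrite mulrC divfK// addrC subrK.
Qed.

Lemma boxcox0 t : boxcox t 0 = 0.
Proof. by rewrite /boxcox mulr0 expR0 subrr mul0r if_same. Qed.

Lemma boxcox0l s : boxcox 0 s = s.
Proof. by rewrite /boxcox eqxx. Qed.

(** Cut the integral over [0, s + u] at s; translating the second piece by s produces the factor
    e^{ts}. *)
Lemma boxcoxD t s u : boxcox t (s + u) = boxcox t s + expR (t * s) * boxcox t u.
Proof.
rewrite /boxcox; have [->|t0] := eqVneq t 0; first by rewrite mul0r expR0 mul1r.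
by rewrite mulrDr expRD; field.
Qed.

Lemma boxcoxN t s : boxcox t (- s) = - boxcox (- t) s.
Proof.
rewrite /boxcox oppr_eq0; have [//|t0] := eqVneq t 0.
by rewrite mulrN mulNr; field.
Qed.

Lemma is_derive_boxcox t s : is_derive s 1 (boxcox t) (expR (t * s)).
Proof.
have [->|t0] := eqVneq t 0.
  rewrite mul0r expR0; have -> : boxcox 0 = id by apply/funext => x; rewrite /boxcox eqxx.
  exact: is_derive_id.
have -> : boxcox t = (fun x => t^-1 * (expR (t * x) - 1)).
  by apply/funext => x; rewrite /boxcox (negbTE t0) mulrC.
apply: is_derive_eq; rewrite subr0 /GRing.scale/= mulr1.
by field.
Qed.

Lemma continuous_boxcox t : continuous (boxcox t).
Proof.
move=> s; apply: differentiable_continuous; apply/derivable1_diffP.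
by have [] := is_derive_boxcox t s.
Qed.

Lemma boxcox_inc t s u : s < u -> boxcox t s < boxcox t u.
Proof.
move=> su.
have [c _ h] : exists2 c, c \in `]s, u[ & boxcox t u - boxcox t s = expR (t * c) * (u - s).
  apply: MVT => // [x _|]; first exact: is_derive_boxcox.
  by apply: continuous_subspaceT => x; exact: continuous_boxcox.
by rewrite -subr_gt0 h mulr_gt0 ?expR_gt0 ?subr_gt0.
Qed.

Lemma boxcox_gt0 t s : 0 < s -> 0 < boxcox t s.
Proof. by move=> s0; rewrite -[ltLHS](boxcox0 t); exact: boxcox_inc. Qed.

(** Mean value theorem in s for the difference of the two transforms. The sign of the bracket yields
    monotonicity in t, its size yields continuity in t. *)
Lemma boxcoxB t t' s : 0 < s -> exists2 c, 0 < c < s &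
  boxcox t' s - boxcox t s = s * (expR (t' * c) - expR (t * c)).
Proof.
move=> s0; have d (x : R) : is_derive x 1 (fun y : R => boxcox t' y - boxcox t y)
    (expR (t' * x) - expR (t * x)).
  have ? := is_derive_boxcox t' x; have ? := is_derive_boxcox t x.
  exact: is_deriveB.
have [c cs h] := @MVT _ (fun y => boxcox t' y - boxcox t y) _ _ _ s0
  (fun x _ => d x) ltac:(by apply: continuous_subspaceT => x;
    apply: cvgB; exact: continuous_boxcox).
exists c; first by move: cs; rewrite in_itv.
by move: h; rewrite !boxcox0 !subr0 => ->; rewrite mulrC.
Qed.

Lemma boxcox_lt t t' s : 0 < s -> t < t' -> boxcox t s < boxcox t' s.
Proof.
move=> s0 tt'; have [c /andP[c0 _] h] := boxcoxB t t' s0.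
by rewrite -subr_gt0 h mulr_gt0// subr_gt0 ltr_expR ltr_pM2r.
Qed.

Lemma boxcox_le t t' s : 0 <= s -> t <= t' -> boxcox t s <= boxcox t' s.
Proof.
rewrite le_eqVlt => /predU1P[<-|s0]; first by rewrite !boxcox0.
by rewrite le_eqVlt => /predU1P[->//|?]; rewrite ltW// boxcox_lt.
Qed.

(** Factor e^{tc} out of the bracket in [boxcoxB] and use |e^z - 1| <= e^{|z|} - 1. The bound
    vanishes as t' tends to t. *)
Lemma boxcoxB_le t t' s : 0 < s ->
  `|boxcox t' s - boxcox t s| <= s * expR (`|t| * s) * (expR (`|t' - t| * s) - 1).
Proof.
move=> s0; have [c /andP[c0 cs] ->] := boxcoxB t t' s0.
have -> : t' * c = t * c + (t' - t) * c by ring.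
rewrite expRD -[X in _ - X]mulr1 -mulrBr !normrM (gtr0_norm s0) (gtr0_norm (expR_gt0 _)) -mulrA.
rewrite ler_pM2l// ler_pM ?expR_ge0//.
  rewrite ler_expR (le_trans (ler_norm _))// normrM (gtr0_norm c0).
  by rewrite ler_wpM2l// ltW.
set z := _ * c.
have zs : `|z| <= `|t' - t| * s by rewrite normrM (gtr0_norm c0) ler_wpM2l// ltW.
apply: (@le_trans _ _ (expR `|z| - 1)); last by rewrite lerD2r ler_expR.
have [z0|z0] := leP 0 z; first by rewrite !ger0_norm// subr_ge0 -expR0 ler_expR.
rewrite !ltr0_norm// ?subr_lt0 -?[ltRHS]expR0 ?ltr_expR// opprB.
have := expR_gt0 z; have := expR_gt0 (-z); have := expRxMexpNx_1 z.
set x := expR z; set y := expR (-z) => xy y0 x0.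
(* For z < 0 the claim is 2 <= x + y; as xy = 1, the difference is a square times y. *)
rewrite -subr_ge0 (_ : _ - _ = (x - 1)^+2 * y); last by rewrite expr2; nra.
by rewrite mulr_ge0 ?sqr_ge0 ?ltW.
Qed.

Lemma continuous_boxcox_param s : 0 < s -> continuous (boxcox ^~ s).
Proof.
move=> s0 t; apply/cvgrPdist_le => /= e e0.
have h : (fun t' => s * expR (`|t| * s) * (expR (`|t' - t| * s) - 1)) x @[x --> t] --> (0 : R).
  rewrite -[X in _ --> X](_ : s * expR (`|t| * s) * (expR (`|t - t| * s) - 1) = 0); last first.
    by rewrite subrr normr0 mul0r expR0 subrr mulr0.
  apply: cvgMr; apply: cvgB; last exact: cvg_cst.
  apply: continuous_cvg; first exact: continuous_expR.
  apply: cvgMl; apply: cvg_norm; apply: cvgB; [exact: cvg_id|exact: cvg_cst].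
move/cvgrPdist_le : h => /(_ _ e0); apply: filterS => t' /=.
rewrite sub0r normrN => h; rewrite distrC (le_trans (boxcoxB_le _ _ s0))//.
exact: le_trans (ler_norm _) h.
Qed.

(** From e^y >= (1 + y/2)^2 with y = ts. The bound is crude but linear in t, which suffices to make
    the excess ratio arbitrarily large or small. *)
Lemma boxcox_ge_sqr t s : 0 <= t -> 0 < s -> t * s ^+ 2 / 4 <= boxcox t s.
Proof.
rewrite le_eqVlt => /predU1P[<-|t0] s0.
  by rewrite !mul0r ltW// boxcox_gt0.
rewrite /boxcox gt_eqF// ler_pdivlMr//.
have -> : t * s = t * s / 2 + t * s / 2 by field.
have := expR_ge1Dx (t * s / 2); rewrite expRD.
have : 0 < t * s by exact: mulr_gt0.
set x := expR _; set y := t * s => y0 hx.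
rewrite (_ : _ * t = y ^+ 2 / 4); last by rewrite /y; field.
by rewrite !expr2; nra.
Qed.

End BoxCox.

(** * The integral [phi] as a Box-Cox transform of the logarithm *)

Section Phi.
Context {R : realType}.
Implicit Types (t s u : R).

(** The substitution x = ln u: one antiderivative of u^{t-1} that covers t = 0 as well. *)
Lemma is_derive_boxcox_ln t u : 0 < u ->
  is_derive u 1 (boxcox t \o @ln R) (u `^ (t - 1)).
Proof.
move=> u0; have ? := is_derive_boxcox t (ln u).
have ? := is_derive1_ln u0.
apply: is_derive_eq; rewrite /GRing.scale/= /powR gt_eqF// mulrBl mul1r expRD.
by rewrite expRN lnK.
Qed.

Lemma continuous_boxcox_ln t u : 0 < u -> {for u, continuous (boxcox t \o @ln R)}.
Proof.
move=> u0; apply: differentiable_continuous; apply/derivable1_diffP.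
by have [] := is_derive_boxcox_ln t u0.
Qed.

Lemma Rintegral_powR t (y z : R) : 0 < y -> y <= z ->
  \int[lebesgue_measure]_(u in `[y, z]) (u `^ (t - 1))
  = boxcox t (ln z) - boxcox t (ln y).
Proof.
move=> y0; rewrite le_eqVlt => /predU1P[->|yz].
  by rewrite set_itv1 Rintegral_set1 subrr.
rewrite /Rintegral (@continuous_FTC2 _ _ (boxcox t \o @ln R))//.
- apply: continuous_in_subspaceT => x; rewrite inE/= in_itv/= => /andP[yx _].
  apply: differentiable_continuous; apply/derivable1_diffP.
  by apply: derivable_powR; rewrite in_itv/= andbT (lt_le_trans y0 yx).
- split.
  + move=> x; rewrite in_itv/= => /andP[yx _].
    by have [] := is_derive_boxcox_ln t (lt_trans y0 yx).
  + by apply: cvg_at_right_filter; exact: continuous_boxcox_ln.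
  + by apply: cvg_at_left_filter; apply: continuous_boxcox_ln; exact: lt_trans yz.
- move=> x; rewrite in_itv/= => /andP[yx _].
  rewrite derive1E; have h := is_derive_boxcox_ln t (lt_trans y0 yx).
  exact: derive_val.
Qed.

Lemma phi_boxcox t (y : R) : 0 < y -> phi t y = boxcox t (ln y).
Proof.
move=> y0; rewrite /phi; case: leP => y1.
  by rewrite Rintegral_powR// ln1 boxcox0 subr0.
by rewrite Rintegral_powR ?ltW// ln1 boxcox0 sub0r opprK.
Qed.

End Phi.

(** * Monotonicity and range of the excess ratio *)

Section ExcessRatio.
Context {R : realType}.
Implicit Types (t A L r : R).

(* For A = ln (k / k') and L = ln k' this is phi_t(1/k) / phi_t(1/k') - 1; in
   this form the numerator decreases in t and the denominator increases. *)
Definition excess_ratio A L t : R := boxcox (- t) A / boxcox t L.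

Lemma excess_ratio_gt0 A L t : 0 < A -> 0 < L -> 0 < excess_ratio A L t.
Proof. by move=> A0 L0; rewrite divr_gt0// boxcox_gt0. Qed.

Lemma excess_ratio_dec A L t t' : 0 < A -> 0 < L -> t < t' ->
  excess_ratio A L t' < excess_ratio A L t.
Proof.
move=> A0 L0 tt'; rewrite /excess_ratio ltr_pdivrMr ?boxcox_gt0// mulrAC.
rewrite ltr_pdivlMr ?boxcox_gt0//.
apply: (@le_lt_trans _ _ (boxcox (- t) A * boxcox t L)).
  by rewrite ler_wpM2r ?ltW ?boxcox_gt0// boxcox_lt// ltrN2.
by rewrite ltr_pM2l ?boxcox_gt0// boxcox_lt.
Qed.

Lemma continuous_excess_ratio A L : 0 < A -> 0 < L -> continuous (excess_ratio A L).
Proof.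
move=> A0 L0 t; apply: cvgM; last first.
  apply: cvgV; first by rewrite gt_eqF// boxcox_gt0.
  exact: continuous_boxcox_param.
apply: (@continuous_comp _ _ _ (fun t => - t) (boxcox ^~ A)).
  exact: opp_continuous.
exact: continuous_boxcox_param.
Qed.

(** For t <= 0 the denominator is at most L and the numerator at least |t| A^2 / 4; the witness
    equates the latter with |r| L. *)
Lemma excess_ratio_ge A L r : 0 < A -> 0 < L -> exists2 t, t <= 0 & r <= excess_ratio A L t.
Proof.
move=> A0 L0; exists (- (4 * L * `|r| / A ^+ 2)).
  by rewrite oppr_le0 !mulr_ge0// ?invr_ge0 ?exprn_ge0// ltW.
set t := _ / _; have t0 : 0 <= t.
  by rewrite !mulr_ge0// ?invr_ge0 ?exprn_ge0// ltW.
rewrite /excess_ratio opprK ler_pdivlMr ?boxcox_gt0//.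
apply: le_trans (boxcox_ge_sqr t0 A0).
rewrite [leRHS](_ : _ = `|r| * L); last by rewrite /t; field; rewrite gt_eqF.
apply: (@le_trans _ _ (`|r| * boxcox (- t) L)).
  by rewrite ler_wpM2r ?ler_norm// ltW// boxcox_gt0.
by rewrite ler_wpM2l// -[leRHS]boxcox0l boxcox_le ?oppr_le0// ltW.
Qed.

(** For t >= 0 the numerator is at most A and the denominator at least t L^2 / 4; the witness makes
    r times the latter equal to A. *)
Lemma excess_ratio_le A L r : 0 < A -> 0 < L -> 0 < r ->
  exists2 t, 0 <= t & excess_ratio A L t <= r.
Proof.
move=> A0 L0 r0; exists (4 * A / r / L ^+ 2).
  by rewrite !mulr_ge0// ?invr_ge0 ?exprn_ge0// ltW.
set t := _ / _ ^+ 2; have t0 : 0 <= t.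
  by rewrite !mulr_ge0// ?invr_ge0 ?exprn_ge0// ltW.
rewrite /excess_ratio ler_pdivrMr ?boxcox_gt0//.
apply: (@le_trans _ _ A).
  by rewrite -[leRHS]boxcox0l boxcox_le ?oppr_le0// ltW.
apply: (@le_trans _ _ (r * (t * L ^+ 2 / 4))).
  by rewrite le_eqVlt; apply/orP; left; apply/eqP; rewrite /t; field; rewrite !gt_eqF.
by rewrite ler_pM2l// boxcox_ge_sqr.
Qed.

Lemma excess_ratio_surj A L r : 0 < A -> 0 < L -> 0 < r -> exists t, excess_ratio A L t = r.
Proof.
move=> A0 L0 r0.
have [t1 t10 h1] := excess_ratio_ge r A0 L0; have [t2 t20 h2] := excess_ratio_le A0 L0 r0.
have [] := @IVT _ (excess_ratio A L) t1 t2 r (le_trans t10 t20).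
- by apply: continuous_subspaceT; exact: continuous_excess_ratio.
- by rewrite ge_min le_max h1 h2 orbT.
- by move=> t _ <-; exists t.
Qed.

Lemma excess_ratio_lt A L t t' : 0 < A -> 0 < L ->
  (excess_ratio A L t' < excess_ratio A L t) = (t < t').
Proof.
move=> A0 L0; case: (ltgtP t t') => [tt'|t't|->]; last by rewrite ltxx.
  exact: excess_ratio_dec.
by apply/negbTE; rewrite -leNgt ltW// excess_ratio_dec.
Qed.

End ExcessRatio.

(** * The estimator as the root of an excess-ratio equation *)

Section Root.
Context {R : realType}.

(** Here phi_t(1/k) = - B_{-t}(ln k), and [boxcoxD] applies to ln k = ln k' + ln (k / k'). *)
Lemma phi_ratio (k k' : nat) (t : R) : (1 < k')%N -> (k' < k)%N ->
  phi t k'%:R^-1 / phi t k%:R^-1 =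
  (1 + excess_ratio (ln (k%:R / k'%:R)) (ln k'%:R) t)^-1.
Proof.
move=> k'1 k'k; have k1 : (1 < k)%N by exact: ltn_trans k'k.
have p0 : (0 : R) < k%:R by rewrite ltr0n ltnW.
have p0' : (0 : R) < k'%:R by rewrite ltr0n ltnW.
have L0 : 0 < ln (k'%:R : R) by rewrite ln_gt0// ltr1n.
have A0 : 0 < ln (k%:R / k'%:R : R) by rewrite ln_gt0// ltr_pdivlMr// mul1r ltr_nat.
rewrite !phi_boxcox ?invr_gt0// !lnV ?posrE// !boxcoxN.
have {1}-> : ln (k%:R : R) = ln k'%:R + ln (k%:R / k'%:R).
  by rewrite -lnM ?posrE ?divr_gt0// mulrC divfK// gt_eqF.
rewrite boxcoxD /excess_ratio.
(* Reflecting [0, ln k'] exchanges t and -t up to an exponential factor; expanding B_t(ln k' - ln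
   k') = 0 gives it. *)
have -> : boxcox t (ln k'%:R) = expR (t * ln k'%:R) * boxcox (- t) (ln k'%:R).
  have := boxcoxD t (ln k'%:R) (- ln (k'%:R)); rewrite subrr boxcox0 boxcoxN mulrN.
  by move/eqP; rewrite eq_sym subr_eq0 => /eqP.
have := boxcox_gt0 (-t) L0; have := boxcox_gt0 (-t) A0.
rewrite (mulNr t) expRN; have := expR_gt0 (t * ln k'%:R).
set e := expR _; set x := boxcox _ _; set y := boxcox _ _ => e0 x0 y0.
by field; rewrite !gt_eqF ?addr_gt0 ?mulr_gt0.
Qed.

Variables (k k' n : nat) (x : nat -> R).
Hypotheses (k'1 : (1 < k')%N) (k'k : (k' < k)%N).
Let A : R := ln (k%:R / k'%:R).
Let L : R := ln k'%:R.
Let v := order_stat x (n - k + 1) n.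
Let u := order_stat x (n - k' + 1) n.
Let M := order_stat x n n.

Let A0 : 0 < A.
Proof.
by rewrite ln_gt0// ltr_pdivlMr ?mul1r ?ltr_nat// ltr0n ltnW.
Qed.

Let L0 : 0 < L. Proof. by rewrite ln_gt0// ltr1n. Qed.

(** With q the excess ratio, the equation says v - M = (1 + q) (u - M), that is u - v = q (M - u).
    If u = M the quotient is 0 by convention, hence not 1; and q > 0 excludes v = u. *)
Lemma xi_equationE t : v <= u -> u <= M -> xi_equation k k' n x t <->
  [/\ v < u, u < M & excess_ratio A L t = (u - v) / (M - u)].
Proof.
move=> vu uM; rewrite /xi_equation phi_ratio// -/u -/v -/M -/A -/L.
have q0 := excess_ratio_gt0 t A0 L0; set q := excess_ratio A L t in q0 *.
split=> [h|[vu' uM' ->]]; last first.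
  field; rewrite subr_eq0 (lt_eqF uM') subr_eq0 (gt_eqF uM') /= gt_eqF//.
  by rewrite addr_gt0 ?subr_gt0.
have uM' : u < M.
  rewrite lt_neqAle uM andbT; apply/eqP => E; move: h.
  by rewrite E subrr invr0 !mulr0 => /eqP; rewrite eq_sym oner_eq0.
have h2 : v - M = (1 + q) * (u - M).
  have q1 : 1 + q != 0 by rewrite gt_eqF// addr_gt0.
  have uM0 : u - M != 0 by rewrite lt_eqF// subr_lt0.
  by move: h => /(canRL (mulVKf q1))/(canRL (divfK uM0)); rewrite mulr1.
split => //; first by have : 0 < q * (M - u); [rewrite mulr_gt0// subr_gt0|lra].
have uM0 : M - u != 0 by rewrite gt_eqF// subr_gt0.
apply: (mulIf uM0); rewrite divfK//; lra.
Qed.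

Lemma xi_hat_default theta0 : v <= u -> u <= M -> ~ (v < u < M) ->
  xi_hat theta0 k k' n x = theta0.
Proof.
move=> vu uM h; rewrite /xi_hat; apply: xgetPN => t /(xi_equationE _ vu uM)[? ? _].
by apply: h; apply/andP.
Qed.

Lemma xi_hatP theta0 : v < u < M ->
  excess_ratio A L (xi_hat theta0 k k' n x) = (u - v) / (M - u).
Proof.
move=> /andP[vu uM]; have r0 : 0 < (u - v) / (M - u) by rewrite divr_gt0 ?subr_gt0.
have [t ht] := excess_ratio_surj A0 L0 r0.
have : xi_equation k k' n x t by apply/(xi_equationE _ (ltW vu) (ltW uM)).
rewrite /xi_hat => h; have := @xgetPex _ theta0 (xi_equation k k' n x) (ex_intro _ t h).
by move/(xi_equationE _ (ltW vu) (ltW uM)) => [].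
Qed.

(** Since [excess_ratio] decreases strictly in t, locating the root amounts to comparing values at
    xi + eps and xi - eps. The right-hand side involves only constants and three order
    statistics. *)
Lemma xi_hat_dist theta0 (xi eps : R) : v < u < M ->
  (`|xi_hat theta0 k k' n x - xi| <= eps) =
  (excess_ratio A L (xi + eps) * (M - u) <= u - v
     <= excess_ratio A L (xi - eps) * (M - u)).
Proof.
move=> W; have Mu : 0 < M - u by rewrite subr_gt0; case/andP: W.
rewrite -(ler_pdivlMr _ _ Mu) -(ler_pdivrMr _ _ Mu) -(xi_hatP theta0 W) ler_distl [in RHS]andbC.
by congr andb; rewrite !leNgt excess_ratio_lt.
Qed.

End Root.

(** * Order statistics of an i.i.d. sample *)

Section OrderStat.
Context {R : realType}.
Implicit Types (x : nat -> R) (y : R).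

(** Reduces every question about an order statistic to one about a sum of indicators. *)
Lemma order_stat_gt x k n y : (0 < k <= n)%N ->
  (y < order_stat x (n - k + 1) n) = (k <= \sum_(i < n) (y < x i)%R)%N.
Proof.
(* Rank n - k + 1 counted from 1 is index n - k of the sorted list. *)
move=> /andP[k0 kn]; rewrite /order_stat addn1/=.
have -> : (\sum_(i < n) (y < x i)%R)%N =
    count (> y) (sort <=%R [seq x i | i <- iota 0 n]).
  rewrite (permP (permEl (perm_sort _ _))) count_map -sum1_count.
  rewrite -(big_mkord xpredT (fun i => nat_of_bool (y < x i))) /index_iota subn0.
  by rewrite [in RHS]big_mkcond; apply: eq_bigr => i _ /=; case: ifP.
set s := sort _ _.
have ss : sorted <=%R s by exact: sort_le_sorted.
have sn : size s = n by rewrite size_sort size_map size_iota.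
have hc : (count (<= y) s + count (> y) s = n)%N.
  by rewrite count_le_gt sn subnK// -sn count_size.
apply/idP/idP => [h|h].
  rewrite leqNgt; apply/negP => ck; move: h; apply/negP; rewrite -leNgt.
  apply: nth_count_le => //; rewrite -hc.
  by rewrite -(leq_add2r k) addSn subnK ?hc// -{1}hc ltn_add2l.
apply: nth_count_gt => //; rewrite sn; apply/andP; split; last first.
  by rewrite ltn_subrL k0 (leq_trans k0).
by rewrite -(leq_add2r k) subnK// -[leqRHS]hc leq_add2l.
Qed.

Lemma order_stat_le x n i j : (i <= j <= n)%N -> (0 < i)%N ->
  order_stat x i n <= order_stat x j n.
Proof.
move=> /andP[ij jn] i0; rewrite /order_stat.
have sn : size (sort <=%R [seq x i | i <- iota 0 n]) = n.
  by rewrite size_sort size_map size_iota.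
have j0 : (0 < j)%N by exact: leq_trans ij.
apply: (le_sorted_leq_nth _ (sort_le_sorted _)); rewrite ?inE ?sn.
- by rewrite prednK// (leq_trans ij).
- by rewrite prednK.
- by rewrite -!subn1 leq_sub2r.
Qed.

End OrderStat.

(** * Chebyshev's inequality for counts of pairwise independent events *)

Section Chebyshev.
Context d (T : measurableType d) (R : realType) (P : probability T R).
Variables (A : nat -> set T) (p : R).
Hypotheses (mA : forall i, measurable (A i)) (PA : forall i, P (A i) = p%:E).
Hypothesis PAI : forall i j, i != j -> P (A i `&` A j) = (p * p)%:E.

Let S n : {RV P >-> R} := \sum_(i < n) (mindic R (mA i) : {mfun T >-> R}).

Lemma Lfun_mindic (B : set T) (mB : measurable B) : (mindic R mB : T -> R) \in Lfun P 2%:E.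
Proof.
rewrite inE; apply/andP; split; rewrite inE//=.
rewrite /finite_norm unlock poweR_lty//.
rewrite (eq_integral (fun x => (\1_B x)%:E)); last first.
  move=> x _ /=; rewrite /mindic indicE; case: (x \in B).
    by rewrite normr1 powR1.
  by rewrite normr0 powR0.
rewrite integral_indic// setIT (le_lt_trans (probability_le1 _ _))// ltry//.
Qed.

Let SS n : (S n.+1 : T -> R) = S n \+ mindic R (mA n).
Proof. by rewrite /S big_ord_recr. Qed.

Let L2S n : (S n : T -> R) \in Lfun P 2%:E.
Proof.
elim: n => [|n IH]; first by rewrite /S big_ord0; exact: Lfun_cst.
by rewrite SS rpredD ?lee1n//= Lfun_mindic.
Qed.

Let L1 (f : T -> R) : f \in Lfun P 2%:E -> f \in Lfun P 1.
Proof. by apply: Lfun_subset12; exact: fin_num_measure. Qed.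

Let ES n : ('E_P[S n] = (n%:R * p)%:E)%E.
Proof.
elim: n => [|n IH].
  by rewrite /S big_ord0 mul0r; exact: expectation_cst.
rewrite SS expectationD ?L1 ?Lfun_mindic// IH expectation_indic// PA -EFinD.
by rewrite -natr1 mulrDl mul1r.
Qed.

Let cov_mindic i j : i != j -> covariance P (mindic R (mA i)) (mindic R (mA j)) = 0%E.
Proof.
move=> ij; rewrite covarianceE ?Lfun2_mul_Lfun1 ?L1 ?Lfun_mindic//.
rewrite (_ : (_ * _)%R = \1_(A i `&` A j)); last by rewrite indicI.
rewrite !expectation_indic//; last exact: measurableI.
by rewrite PAI// !PA -EFinM subee.
Qed.

Let covS n m : (n <= m)%N -> covariance P (S n) (mindic R (mA m)) = 0%E.
Proof.
elim: n => [|n IH] nm.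
  by rewrite /S big_ord0; exact: covariance_cst_l.
rewrite SS covarianceDl ?Lfun_mindic// IH ?(ltnW nm)// add0e.
by rewrite cov_mindic// ltn_eqF.
Qed.

Let VS n : ('V_P[S n] = (n%:R * (p * (1 - p)))%:E)%E.
Proof.
elim: n => [|n IH].
  by rewrite /S big_ord0 mul0r; exact: variance_cst.
rewrite SS varianceD ?Lfun_mindic// IH covS// mule0 adde0.
rewrite varianceE ?Lfun_mindic//.
rewrite (_ : (_ ^+ 2)%R = \1_(A n)); last first.
  apply/funext => x; rewrite /mindic fctE/= expr2 indicE.
  by case: (x \in A n); rewrite ?mulr1 ?mulr0.
rewrite !expectation_indic// !PA -EFin_expe -EFinB -EFinD -natr1; congr EFin; ring.
Qed.

(** Pairwise independence kills the covariances, so the variance is n p (1 - p); it is weakened to n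
    p. *)
Lemma chebyshev_count n (e : R) : 0 < e ->
  (P [set w | (e <= `|(\sum_(i < n) (w \in A i))%:R - n%:R * p|)%R]
     <= (n%:R * p / e ^+ 2)%:E)%E.
Proof.
move=> e0; have := chebyshev (S n) e0; rewrite ES VS.
have -> : [set w | e <= `|(\sum_(i < n) (w \in A i))%:R - n%:R * p|] =
    [set w | e <= `|S n w - n%:R * p|].
  apply/funext => w /=; congr (is_true (_ <= `|_ - _|)); rewrite /S mfun_sum natr_sum.
  by apply: eq_bigr => i _; rewrite mindicE.
move=> /le_trans; apply; rewrite -EFinM lee_fin mulrC.
have p0 : 0 <= p by rewrite -lee_fin -(PA 0%N).
rewrite ler_wpM2r ?invr_ge0 ?exprn_ge0 ?(ltW e0)// ler_wpM2l//.
by rewrite ler_piMr// gerBl.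
Qed.

Lemma measurable_count n (B : set R) : measurable B ->
  measurable [set w | B (\sum_(i < n) (w \in A i))%:R].
Proof.
move=> mB; have := measurable_funP (S n) measurableT _ mB.
rewrite setTI; congr measurable; apply/funext => w /=; congr B.
rewrite /S mfun_sum natr_sum.
by apply: eq_bigr => i _; rewrite mindicE.
Qed.

Let measurable_dist n (e : R) :
  measurable [set w | e <= `|(\sum_(i < n) (w \in A i))%:R - n%:R * p|].
Proof.
apply: (@measurable_count n [set z | e <= `|z - n%:R * p|]).
rewrite (_ : mkset _ = `]-oo, n%:R * p - e] `|` `[n%:R * p + e, +oo[).
  by apply: measurableU; exact: measurable_itv.
apply/seteqP; split => z /=; rewrite !in_itv/= andbT ler_normr.
  by move=> /orP[] h; [right|left]; lra.
by move=> [] h; apply/orP; [right|left]; lra.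
Qed.

Lemma count_ge_le n (k : nat) : n%:R * p < k%:R ->
  (P [set w | (k <= \sum_(i < n) (w \in A i))%N] <=
    (n%:R * p / (k%:R - n%:R * p) ^+ 2)%:E)%E.
Proof.
move=> h; rewrite -subr_gt0 in h; apply: le_trans (chebyshev_count n h).
apply: le_measure; rewrite ?inE//.
- have := measurable_count n (measurable_itv `[k%:R, +oo[); congr measurable.
  by apply/funext => w /=; rewrite in_itv/= andbT ler_nat.
- move=> w /=; rewrite -(@ler_nat R) => hw.
  by rewrite (le_trans _ (ler_norm _))// lerD2r.
Qed.

Lemma count_lt_le n (k : nat) : k%:R < n%:R * p ->
  (P [set w | (\sum_(i < n) (w \in A i) < k)%N] <=
    (n%:R * p / (n%:R * p - k%:R) ^+ 2)%:E)%E.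
Proof.
move=> h; rewrite -subr_gt0 in h; apply: le_trans (chebyshev_count n h).
apply: le_measure; rewrite ?inE//.
- have := measurable_count n (measurable_itv `]-oo, k%:R[); congr measurable.
  by apply/funext => w /=; rewrite in_itv/= ltr_nat.
- move=> w /=; rewrite -(@ltr_nat R) => hw.
  by rewrite distrC (le_trans _ (ler_norm _))// lerD2l lerN2 ltW.
Qed.

End Chebyshev.

(** * Maxima and order statistics of i.i.d. variables *)

Definition tail {R : realType} (F : R -> R) (y : R) : R := 1 - F y.

Section IID.
Context d (T : measurableType d) (R : realType) (P : probability T R).
Variables (X : nat -> {RV P >-> R}) (F : R -> R).
Hypothesis iidX : iid_RVs F X.

(** The index [n.+1] keeps the sample nonempty: the maximum of no terms defaults to [x 0], for which
    the power formula fails. *)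
Lemma sample_max_cdf n y :
  P [set w | sample_max (fun i => X i w) n.+1 <= y] = (F y ^+ n.+1)%:E.
Proof.
have [indep cdfX] := iidX.
have PX i : P (X i @^-1` `]-oo, y]) = (F y)%:E by exact: cdfX.
have := indep [fset i in iota 0 n.+1]%fset (fun=> `]-oo, y]%classic)
  (fun=> measurable_itv _).
rewrite (perm_big (iota 0 n.+1)); last first.
  apply: uniq_perm; rewrite ?fset_uniq ?iota_uniq// => i.
  by rewrite !inE.
rewrite (eq_bigr (fun=> (F y)%:E)); last by move=> i _; exact: PX.
rewrite prodEFin big_const_seq count_predT size_iota iter_mulr_1 => <-.
have memJ i : (i \in [fset i in iota 0 n.+1]%fset) = (i < n.+1)%N.
  by rewrite !inE mem_iota; case: i.
congr (P _); apply/seteqP; split => w /=.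
  move=> h i; rewrite /= memJ => iln.
  rewrite in_itv/=; apply: le_trans h.
  exact: (@le_bigmax _ _ _ _ (fun i : 'I_n.+1 => X i w) (Ordinal iln)).
move=> h; apply/bigmax_leP; split => [|i _].
  by have := h 0%N; rewrite /= memJ in_itv/=; apply.
by have := h i; rewrite /= memJ in_itv/=; apply; exact: ltn_ord.
Qed.

Lemma cdf01 y : 0 <= F y <= 1.
Proof.
have [_ cdfX] := iidX; rewrite -!lee_fin -(cdfX 0%N) cdf_ge0 /=.
by rewrite cdf_le1.
Qed.

Lemma tail_ge0 y : 0 <= tail F y.
Proof. by rewrite subr_ge0; have /andP[] := cdf01 y. Qed.

Lemma tail_le (y z : R) : y <= z -> tail F z <= tail F y.
Proof.
have [_ cdfX] := iidX; move=> yz; rewrite lerD2l lerN2 -lee_fin -!(cdfX 0%N).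
exact: cdf_nondecreasing.
Qed.

Let gt_event y i := X i @^-1` `]y, +oo[%classic.

Let measurable_gt_event y i : measurable (gt_event y i).
Proof. by rewrite -[gt_event y i]setTI; apply: measurable_funP => //; exact: measurable_itv. Qed.

Let P_gt_event y i : P (gt_event y i) = (tail F y)%:E.
Proof.
have [_ cdfX] := iidX.
rewrite -[gt_event y i]setCK probability_setC; last exact: measurableC.
rewrite /tail EFinB -(cdfX i); congr (_ - P _)%E.
apply/seteqP; split => w; rewrite /gt_event/= !in_itv/= andbT.
  by move=> /negP; rewrite -leNgt.
by rewrite leNgt => /negP.
Qed.

Let P_gt_eventI y i j : i != j -> P (gt_event y i `&` gt_event y j) = (tail F y * tail F y)%:E.
Proof.
have [indep _] := iidX; move=> ij.
have := indep [fset i; j]%fset (fun=> `]y, +oo[%classic) (fun=> measurable_itv _).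
rewrite (perm_big [:: i; j]); last first.
  apply: uniq_perm; rewrite ?fset_uniq//=; first by rewrite !inE ij.
  by move=> m; rewrite !inE.
rewrite (eq_bigr (fun=> (tail F y)%:E)); last by move=> m _; exact: P_gt_event.
rewrite prodEFin !big_cons big_nil mulr1 => <-.
congr (P _); apply/seteqP; split => w /=.
  by move=> [h1 h2] m /=; rewrite !inE => /orP[] /eqP ->.
by move=> h; split; apply: h; rewrite /= !inE eqxx ?orbT.
Qed.

Let order_stat_gtE y k n w : (0 < k <= n)%N ->
  (y < order_stat (fun i => X i w) (n - k + 1) n) =
  (k <= \sum_(i < n) (w \in gt_event y i))%N.
Proof.
move=> kn; rewrite order_stat_gt//; congr (_ <= _)%N.
apply: eq_bigr => i _; congr nat_of_bool.
by apply/idP/idP; rewrite inE /gt_event/= in_itv/= andbT.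
Qed.

Let order_stat_event y k n : (0 < k <= n)%N ->
  [set w | y < order_stat (fun i => X i w) (n - k + 1) n] =
  [set w | (k <= \sum_(i < n) (w \in gt_event y i))%N].
Proof. by move=> kn; apply/funext => w /=; rewrite order_stat_gtE. Qed.

(** The rays ]y, +oo[ generate the Borel sets, and their preimages are events about exceedance
    counts. *)
Lemma measurable_order_stat k n : (0 < k <= n)%N ->
  measurable_fun [set: T] (fun w => order_stat (fun i => X i w) (n - k + 1) n).
Proof.
move=> kn mT; apply: (measurability _ (RGenOInfty.measurableE R)) => //.
move=> /= _ [_ [y ->] <-]; rewrite setTI.
rewrite (_ : _ @^-1` _ = [set w | y < order_stat (fun i => X i w) (n - k + 1) n]); last first.
  by apply/funext => w /=; rewrite in_itv/= andbT.
rewrite order_stat_event//.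
have := measurable_count P (measurable_gt_event y) n (measurable_itv `[k%:R : R, +oo[).
congr measurable.
by apply/funext => w /=; rewrite in_itv/= andbT ler_nat.
Qed.

Lemma order_stat_gt_le y k n : (0 < k <= n)%N -> n%:R * tail F y < k%:R ->
  (P [set w | (y < order_stat (fun i => X i w) (n - k + 1) n)%R] <=
    (n%:R * tail F y / (k%:R - n%:R * tail F y) ^+ 2)%:E)%E.
Proof.
move=> kn h; rewrite order_stat_event//.
by have := count_ge_le (measurable_gt_event y) (P_gt_event y) (@P_gt_eventI y) h.
Qed.

Lemma order_stat_le_le y k n : (0 < k <= n)%N -> k%:R < n%:R * tail F y ->
  (P [set w | (order_stat (fun i => X i w) (n - k + 1) n <= y)%R] <=
    (n%:R * tail F y / (n%:R * tail F y - k%:R) ^+ 2)%:E)%E.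
Proof.
move=> kn h.
have := count_lt_le (measurable_gt_event y) (P_gt_event y) (@P_gt_eventI y) h.
congr (P _ <= _)%E; apply/funext => w /=.
by rewrite [in RHS]leNgt order_stat_gtE// ltnNge.
Qed.

End IID.

(** * Domains of attraction *)

Lemma cvg_lt_near {R : realType} {I : Type} {G : set_system I} {FG : Filter G}
    (u v : I -> R) (l m : R) :
  u @ G --> l -> v @ G --> m -> l < m -> \forall i \near G, u i < v i.
Proof.
move=> ul vm lm; have lc : l < (l + m) / 2 by lra.
have cm : (l + m) / 2 < m by lra.
near=> i; apply: (@lt_trans _ _ ((l + m) / 2)); near: i.
  exact: cvgr_lt ul _ lc.
exact: cvgr_gt vm _ cm.
Unshelve. all: end_near. Qed.

(** As 1 + xi B_xi(s) = e^{xi s} > 0, the degenerate branches of [gev] never occur: in the variable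
    s every extreme value law is the Gumbel law. *)
Lemma gev_boxcox {R : realType} (xi s : R) :
  gev xi (boxcox xi s) = expR (- expR (- s)).
Proof.
rewrite /gev boxcoxE; have [->|xi0] := eqVneq xi 0; first by rewrite boxcox0l.
rewrite expR_gt0 /powR gt_eqF ?expR_gt0// expRK.
by congr (expR (- expR _)); field.
Qed.

(** By [boxcoxD] the left side is B_t(L) + e^{tL} B_t(C). The first term is at most B_t'(L); the
    second is absorbed because B_t'(L) dominates e^{tL} by an exponentially growing factor. *)
Lemma boxcox_growth {R : realType} (t t' C g : R) : t < t' -> 0 < g ->
  \forall L \near +oo, boxcox t (L + C) <= (1 + g) * boxcox t' L.
Proof.
move=> tt' g0.
have [s [k [s0 k0 h]]] : exists s k : R, [/\ 0 < s, 0 < k &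
    forall L, 1 <= L -> expR (t * L) * (expR (s * L) * k) <= boxcox t' L].
  have mono u L : 1 <= L -> boxcox u 1 <= boxcox u L.
    by rewrite le_eqVlt => /predU1P[<-//|/(boxcox_inc u)/ltW].
  (* If t' > 0, reflection shows that B_t'(L) is at least of order e^{t'L}, so s = t' - t. Otherwise
     t < 0 and B_t'(L) is bounded below, so s = - t. *)
  have [t'0|t'0] := ltP 0 t'.
    exists (t' - t), (boxcox (- t') 1); split; rewrite ?subr_gt0 ?boxcox_gt0// => L L1.
    have -> : boxcox t' L = expR (t' * L) * boxcox (- t') L.
      have := boxcoxD t' L (- L); rewrite subrr boxcox0 boxcoxN mulrN.
      by move/eqP; rewrite eq_sym subr_eq0 => /eqP.
    rewrite mulrA -expRD -mulrDl subrKC ler_pM2l ?expR_gt0//; exact: mono.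
  exists (- t), (boxcox t' 1); split; rewrite ?oppr_gt0 ?boxcox_gt0//; first lra.
  by move=> L L1; rewrite mulrA -expRD -mulrDl subrr mul0r expR0 mul1r; exact: mono.
near=> L.
have L1 : 1 <= L by near: L; exact: nbhs_pinfty_ge.
have L0 : 0 < L by exact: lt_le_trans L1.
rewrite boxcoxD mulrDl mul1r lerD//; first by rewrite boxcox_le// ltW.
apply: le_trans (ler_wpM2l (ltW g0) (h L L1)).
rewrite mulrCA ler_pM2l ?expR_gt0//.
(* The exponential is bounded below by s L, which eventually beats the constant B_t(C). *)
apply: (@le_trans _ _ (g * (s * L * k))); last first.
  rewrite ler_pM2l// ler_pM2r// (le_trans _ (expR_ge1Dx _))// lerDr//.
have -> : g * (s * L * k) = g * s * k * L by ring.
rewrite mulrC -ler_pdivrMr ?mulr_gt0//.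
Unshelve. all: end_near. Qed.

Section Attraction.
Context {R : realType}.
Variables (F : R -> R) (a b : nat -> R) (xi : R).
Hypotheses (F01 : forall y, 0 <= F y <= 1) (Fmono : {homo F : x y / x <= y}).
Hypothesis a0 : forall n, 0 < a n.
Hypothesis FG : forall x, F (a n * x + b n) ^+ n @[n --> \oo] --> gev xi x.

Local Notation p := (tail F).

(* With l = - n ln F one has (1 - l / n) l <= n (1 - F) <= l. *)
Lemma attraction_tail s :
  n%:R * p (a n * boxcox xi s + b n) @[n --> \oo] --> expR (- s).
Proof.
pose f n := F (a n * boxcox xi s + b n).
have fg : f n ^+ n @[n --> \oo] --> expR (- expR (- s)).
  by rewrite -(gev_boxcox xi s); exact: FG.
pose l n := - ln (f n ^+ n).
have lg : l n @[n --> \oo] --> expR (- s).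
  rewrite -[X in _ --> X]opprK -[X in _ --> - X]expRK; apply: cvgN.
  by apply: continuous_cvg fg; apply: continuous_ln; exact: expR_gt0.
have lg' : (1 - l n / n%:R) * l n @[n --> \oo] --> expR (- s).
  rewrite -[X in _ --> X]mul1r; apply: cvgM => //.
  rewrite -[X in _ --> X]subr0; apply: cvgB; first exact: cvg_cst.
  rewrite -[X in _ --> X](mulr0 (expR (- s))); apply: cvgM => //.
  apply/gtr0_cvgV0; last exact: cvgr_idn.
  by near=> n; rewrite ltr0n; near: n; exact: nbhs_infty_gt.
apply: squeeze_cvgr lg' lg; near=> n.
have n0 : (0 < n)%N by near: n; exact: nbhs_infty_gt.
have n0R : (0 : R) < n%:R by rewrite ltr0n.
have fn0 : 0 < f n ^+ n.
  by near: n; exact: cvgr_gt fg _ (expR_gt0 _).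
have f0 : 0 < f n.
  by rewrite lt_neqAle eq_sym (andP (F01 _)).1 andbT; apply: contraTneq fn0 => ->;
    rewrite expr0n gtn_eqF// ltxx.
have f1 : f n <= 1 by have /andP[] := F01 (a n * boxcox xi s + b n).
have lE : l n = n%:R * (- ln (f n)) by rewrite /l lnXn// mulrN mulr_natl.
have l0 : 0 <= l n by rewrite lE mulr_ge0// oppr_ge0 ln_le0.
have up : n%:R * p (a n * boxcox xi s + b n) <= l n.
  rewrite lE ler_pM2l// /tail -/(f n).
  have := @le_ln1Dx _ (f n - 1); rewrite subrKC => h.
  by have := h ltac:(lra); lra.
(* The bound [up] gives 1 - l / n <= f; the rest is - f ln f <= 1 - f, from ln x <= x - 1 at x = 1 /
   f. *)
rewrite up andbT; apply: (@le_trans _ _ (f n * l n)).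
  rewrite ler_wpM2r//.
  have : p (a n * boxcox xi s + b n) <= l n / n%:R by rewrite ler_pdivlMr// mulrC.
  by rewrite /tail -/(f n); lra.
rewrite lE mulrCA ler_pM2l// /tail -/(f n).
have := @le_ln1Dx _ ((f n)^-1 - 1); rewrite subrKC lnV ?posrE// => h.
have fi0 : 0 < (f n)^-1 by rewrite invr_gt0.
have {}h : - ln (f n) <= (f n)^-1 - 1 by apply: h; lra.
apply: le_trans (ler_wpM2l (ltW f0) h) _.
by rewrite mulrBr mulfV ?gt_eqF// mulr1.
Unshelve. all: end_near. Qed.

(** For s1 < s < s2 the limits e^{-s1} > e^{-s} > e^{-s2} are strictly ordered, so monotonicity of
    the tail traps [y n] between the levels of s1 and s2; continuity of [boxcox xi] closes the
    gap. *)
Lemma attraction_inverse (y : nat -> R) s :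
  n%:R * p (y n) @[n --> \oo] --> expR (- s) ->
  (y n - b n) / a n @[n --> \oo] --> boxcox xi s.
Proof.
move=> ys.
have lo s1 : s1 < s -> \forall n \near \oo, boxcox xi s1 < (y n - b n) / a n.
  move=> s1s; have : expR (- s) < expR (- s1) by rewrite ltr_expR ltrN2.
  move=> /(cvg_lt_near ys (@attraction_tail s1)); apply: filterS => n h.
  rewrite ltr_pdivlMr// mulrC ltrBrDr ltNge; apply: contraTN h => h.
  by rewrite -leNgt ler_wpM2l// lerD2l lerN2 Fmono.
have hi s2 : s < s2 -> \forall n \near \oo, (y n - b n) / a n < boxcox xi s2.
  move=> ss2; have : expR (- s2) < expR (- s) by rewrite ltr_expR ltrN2.
  move=> /(cvg_lt_near (@attraction_tail s2) ys); apply: filterS => n h.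
  rewrite ltr_pdivrMr// mulrC ltrBlDr ltNge; apply: contraTN h => h.
  by rewrite -leNgt ler_wpM2l// lerD2l lerN2 Fmono.
apply/cvgrPdist_lt => e e0.
have /cvgrPdist_lt/(_ e e0) := @continuous_boxcox R xi s.
move=> /nbhs_ballP[r /= r0 hr].
have b1 : ball s r (s - r / 2).
  by rewrite /ball/= opprB addrC subrK gtr0_norm; lra.
have b2 : ball s r (s + r / 2).
  by rewrite /ball/= opprD addNKr normrN gtr0_norm; lra.
have := hr _ b1; have := hr _ b2; rewrite /= !ltr_distl.
move=> /andP[h2 _] /andP[_ h1].
have s1 : s - r / 2 < s by lra.
have s2 : s < s + r / 2 by lra.
near=> n; have : boxcox xi (s - r / 2) < (y n - b n) / a n by near: n; exact: lo.
have : (y n - b n) / a n < boxcox xi (s + r / 2) by near: n; exact: hi.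
by move=> u1 u2; rewrite ltr_distl; apply/andP; split; lra.
Unshelve. all: end_near. Qed.

(** At the level b_{rn}, rn times the tail tends to 1, so n times the tail tends to 1 / r = e^{- ln
    r}. *)
Lemma attraction_location (r : nat) : (0 < r)%N ->
  (b (r * n)%N - b n) / a n @[n --> \oo] --> boxcox xi (ln r%:R).
Proof.
move=> r0; apply: attraction_inverse.
have rp : (0 : R) < r%:R by rewrite ltr0n.
rewrite expRN lnK ?posrE//.
have h : (r * n)%:R * p (b (r * n)%N) @[n --> \oo] --> (1 : R).
  have := @attraction_tail 0; rewrite oppr0 expR0 boxcox0.
  under eq_fun do rewrite mulr0 add0r.
  have rn : (r * n)%N @[n --> \oo] --> \oo.
    exact: cvg_mulnl.
  by move=> h0; exact: (cvg_comp _ _ rn h0).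
rewrite -[X in _ --> X]mulr1.
have : r%:R^-1 * ((r * n)%:R * p (b (r * n)%N)) @[n --> \oo] --> (r%:R^-1 * 1 : R).
  by apply: cvgM h; exact: cvg_cst.
under eq_fun do rewrite natrM -mulrA mulKf ?gt_eqF//.
by [].
Qed.

(** [attraction_location] with r = 2 and r = 4 gives the limits of both increments divided by a_n,
    and t < xi < t' leaves strict room. Increments are compared with each other, so a_{2n} never
    enters and the bounds can be iterated. *)
Lemma attraction_step t t' : t < xi -> xi < t' -> \forall n \near \oo,
  [/\ a n * boxcox t (ln 2) <= b (2 * n)%N - b n,
      b (2 * n)%N - b n <= a n * boxcox t' (ln 2),
      expR (t * ln 2) * (b (2 * n)%N - b n) <= b (2 * (2 * n))%N - b (2 * n)%N &
      b (2 * (2 * n))%N - b (2 * n)%N <= expR (t' * ln 2) * (b (2 * n)%N - b n)].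
Proof.
move=> txi xit'; have L2 : 0 < ln 2 :> R by rewrite ln_gt0// ltr1n.
have h2 := @attraction_location 2 isT; have h4 := @attraction_location 4 isT.
pose x := boxcox xi (ln 2); have x0 : 0 < x by exact: boxcox_gt0.
have h42 : (b (2 * (2 * n))%N - b (2 * n)%N) / a n @[n --> \oo] --> expR (xi * ln 2) * x.
  have -> : expR (xi * ln 2) * x = boxcox xi (ln 4) - x.
    have -> : 4 = 2 * 2 :> R by rewrite -natrM.
    by rewrite lnM ?posrE// boxcoxD addrC addKr.
  rewrite (_ : (fun n => _) = (fun n => (b (4 * n)%N - b n) / a n - (b (2 * n)%N - b n) / a n)).
    exact: cvgB.
  by apply/funext => n; rewrite -mulrBl mulnA; congr (_ / _); lra.
have ex u v : u < v -> expR (u * ln 2) < expR (v * ln 2) :> R.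
  by move=> uv; rewrite ltr_expR ltr_pM2r.
near=> n.
have an := a0 n.
split.
- rewrite mulrC -ler_pdivlMr//; apply: ltW; near: n.
  by apply: cvgr_gt h2 _ _; exact: boxcox_lt.
- rewrite [leRHS]mulrC -ler_pdivrMr//; apply: ltW; near: n.
  by apply: cvgr_lt h2 _ _; exact: boxcox_lt.
- rewrite -(@ler_pM2r _ (a n)^-1) ?invr_gt0// -mulrA; apply: ltW; near: n.
  apply: cvg_lt_near h42 _; first by apply: cvgMr; exact: h2.
  by rewrite ltr_pM2r// ex.
- rewrite -(@ler_pM2r _ (a n)^-1) ?invr_gt0// -[leRHS]mulrA; apply: ltW; near: n.
  apply: cvg_lt_near h42 _ _; first by apply: cvgMr; exact: h2.
  by rewrite ltr_pM2r// ex.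
Unshelve. all: end_near. Qed.

(* Potter-type bounds along dyadic blocks: the increments b_{2n} - b_n grow
   geometrically with ratio about 2^xi, and summing a geometric series of ratio
   2^t gives exactly boxcox t (j ln 2). *)
Lemma attraction_potter t t' : t < xi -> xi < t' -> \forall n \near \oo, forall j,
  a n * boxcox t (j%:R * ln 2) <= b (2 ^ j * n)%N - b n <= a n * boxcox t' (j%:R * ln 2).
Proof.
move=> txi xit'; have [N _ hN] := attraction_step txi xit'.
near=> n.
have nN : (N <= n)%N by near: n; exact: nbhs_infty_ge.
have step i : a n * boxcox t (ln 2) * expR (t * (i%:R * ln 2)) <=
    b (2 ^ i.+1 * n)%N - b (2 ^ i * n)%N <= a n * boxcox t' (ln 2) * expR (t' * (i%:R * ln 2)).
  elim: i => [|i /andP[IH1 IH2]].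
    rewrite !mul0r !mulr0 expR0 !mulr1 mul1n expn1.
    by have [-> -> _ _] := hN n nN.
  (* The threshold [N] serves at every 2^i n, which makes the bounds uniform in j. *)
  have Ni : (N <= 2 ^ i * n)%N by rewrite (leq_trans nN)// leq_pmull// expn_gt0.
  have [_ _ h3 h4] := hN _ Ni.
  have E m : (2 * (2 ^ m * n) = 2 ^ m.+1 * n)%N by rewrite expnS mulnA.
  rewrite !E in h3 h4; move: h3 h4 IH1 IH2.
  move: (b (2 ^ i.+2 * n)%N) (b (2 ^ i.+1 * n)%N) (b (2 ^ i * n)%N) => z2 z1 z0 h3 h4 IH1 IH2.
  rewrite -[i.+1%:R]natr1 mulrDl mul1r !mulrDr !expRD; apply/andP; split.
    by rewrite mulrA mulrC (le_trans _ h3)// ler_pM2l ?expR_gt0.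
  by rewrite mulrA (le_trans h4)// [leRHS]mulrC ler_pM2l ?expR_gt0.
elim=> [|j /andP[IH1 IH2]].
  by rewrite mul0r mul1n !boxcox0 subrr mulr0 lexx.
have /andP[s1 s2] := step j.
rewrite -[j.+1%:R]natr1 mulrDl mul1r !boxcoxD !mulrDr.
rewrite -!mulrA in s1 s2; rewrite [boxcox t _ * _]mulrC in s1; rewrite [boxcox t' _ * _]mulrC in s2.
by apply/andP; split; lra.
Unshelve. all: end_near. Qed.

End Attraction.

(** * Consistency *)

Section Bracket.
Context {R : realType}.
Implicit Types (xi eps ell A L : R).

(** Midpoints lo and hi separate D = B_{-xi}(ell) from its values at xi + eps and xi - eps; a small
    enough relative error g then fits in the gaps. *)
Lemma bracket_constants xi eps ell : 0 < eps -> 0 < ell ->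
  exists g lo hi : R, [/\ 0 < g < 1,
    boxcox (- (xi + eps)) ell < lo < lo * (1 + 2 * g) &
    lo * (1 + 2 * g) <= boxcox (- xi) ell - g] /\
    [/\ hi < boxcox (- (xi - eps)) ell &
    (boxcox (- xi) ell + g) * (1 + g) <= hi * (1 - g)].
Proof.
move=> e0 l0; pose D := boxcox (- xi) ell.
pose Dm := boxcox (- (xi + eps)) ell; pose Dp := boxcox (- (xi - eps)) ell.
have Dm0 : 0 < Dm by exact: boxcox_gt0.
have DmD : Dm < D by apply: boxcox_lt => //; lra.
have DDp : D < Dp by apply: boxcox_lt => //; lra.
rewrite -/D -/Dm -/Dp; pose lo := (Dm + D) / 2; pose hi := (D + Dp) / 2.
(* [g1] solves lo (1 + 2 g) = D - g. [g2] solves D + g (D + 2) = hi (1 - g), which suffices because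
   g^2 <= g for g <= 1. *)
pose g1 := (D - lo) / (2 * lo + 1); pose g2 := (hi - D) / (D + 2 + hi).
have g1d : g1 * (2 * lo + 1) = D - lo by rewrite /g1 divfK// gt_eqF// /lo; lra.
have g2d : g2 * (D + 2 + hi) = hi - D by rewrite /g2 divfK// gt_eqF// /hi; lra.
have g10 : 0 < g1 by rewrite divr_gt0// /lo; lra.
have g20 : 0 < g2 by rewrite divr_gt0// /hi; lra.
have g21 : g2 < 1 by rewrite ltr_pdivrMr /hi; lra.
have hl : Dm < lo by rewrite /lo; lra.
have hh : hi < Dp by rewrite /hi; lra.
have h0 : D < hi by rewrite /hi; lra.
exists (Num.min g1 g2), lo, hi; set g := Num.min _ _.
have gg1 : g <= g1 by rewrite ge_min lexx.
have gg2 : g <= g2 by rewrite ge_min lexx orbT.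
have g0 : 0 < g by rewrite lt_min g10.
split; split.
- by rewrite g0 (le_lt_trans gg2).
- by rewrite hl/=; nra.
- nra.
- exact: hh.
- nra.
Qed.

(** In the scale (a_m, b_m), the points r and -r will bracket X_{n-k'+1,n}, and -ell - r, -ell + r
    will bracket X_{n-k+1,n}. Since B_{-xi}(ell) = B_xi(0) - B_xi(-ell), continuity at 0 and -ell
    provides r. *)
Lemma bracket_radius xi ell g (e : R) : 0 < g -> 0 < e -> exists2 r : R, 0 < r &
  [/\ boxcox xi r - boxcox xi (- ell - r) <= boxcox (- xi) ell + g,
      boxcox (- xi) ell - g <= boxcox xi (- r) - boxcox xi (- ell + r),
      - e <= boxcox xi (- r) & boxcox xi r <= e].
Proof.
move=> g0 e0; have D : boxcox (- xi) ell = boxcox xi 0 - boxcox xi (- ell).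
  by rewrite boxcox0 sub0r boxcoxN opprK.
have c1 : (fun r => boxcox xi (- r)) x @[x --> (0 : R)^'+] --> boxcox xi 0.
  apply: cvg_at_right_filter; rewrite -[X in boxcox xi X]oppr0.
  by apply: continuous_comp; [exact: opp_continuous|exact: continuous_boxcox].
have c2 : (fun r => boxcox xi r) x @[x --> (0 : R)^'+] --> boxcox xi 0.
  by apply: cvg_at_right_filter; exact: continuous_boxcox.
have c3 : (fun r => boxcox xi (- ell - r)) x @[x --> (0 : R)^'+] --> boxcox xi (- ell).
  apply: cvg_at_right_filter; rewrite -[X in _ --> boxcox xi X]subr0.
  apply: (@continuous_comp _ _ _ (fun r => - ell - r) (boxcox xi)).
    by apply: cvgB; [exact: cvg_cst|exact: cvg_id].
  exact: continuous_boxcox.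
have c4 : (fun r => boxcox xi (- ell + r)) x @[x --> (0 : R)^'+] --> boxcox xi (- ell).
  apply: cvg_at_right_filter; rewrite -[X in _ --> boxcox xi X]addr0.
  apply: (@continuous_comp _ _ _ (fun r => - ell + r) (boxcox xi)).
    by apply: cvgD; [exact: cvg_cst|exact: cvg_id].
  exact: continuous_boxcox.
rewrite boxcox0 in D; rewrite boxcox0 in c1; rewrite boxcox0 in c2.
near (0 : R)^'+ => r; exists r => //; rewrite D; split; apply: ltW; near: r.
- by apply: cvgr_lt (cvgB c2 c3) _ _; rewrite ltrDl.
- by apply: cvgr_gt (cvgB c1 c4) _ _; rewrite ltrBlDr ltrDl.
- by apply: cvgr_gt c1 _ _; rewrite oppr_lt0.
- exact: cvgr_lt c2 _ e0.
Unshelve. all: end_near. Qed.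

(* Here v, u, M stand for X_{n-k+1,n}, X_{n-k'+1,n}, X_{n,n}, and al, be for the
   norming constants a_m, b_m of block size m = n %/ k'. *)
Lemma bracket_excess_ratio (xi eps ell A L L1 L2 t t' g lo hi r al be u v M : R) :
  0 < al -> 0 < A -> 0 < L -> 0 < L1 ->
  0 < g < 1 ->
  boxcox (- (xi + eps)) A <= lo -> lo * (1 + 2 * g) <= boxcox (- xi) ell - g ->
  hi <= boxcox (- (xi - eps)) A ->
  (boxcox (- xi) ell + g) * (1 + g) <= hi * (1 - g) ->
  boxcox xi r - boxcox xi (- ell - r) <= boxcox (- xi) ell + g ->
  boxcox (- xi) ell - g <= boxcox xi (- r) - boxcox xi (- ell + r) ->
  - (g * boxcox (xi + eps) L) <= boxcox xi (- r) ->
  boxcox xi r <= g * boxcox t L1 ->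
  boxcox (xi - eps) L <= (1 + g) * boxcox t L1 ->
  boxcox t' L2 <= (1 + g) * boxcox (xi + eps) L ->
  be + al * boxcox xi (- r) < u <= be + al * boxcox xi r ->
  be + al * boxcox xi (- ell - r) < v <= be + al * boxcox xi (- ell + r) ->
  be + al * boxcox t L1 < M <= be + al * boxcox t' L2 ->
  [/\ v < u, u < M & excess_ratio A L (xi + eps) * (M - u) <= u - v
     <= excess_ratio A L (xi - eps) * (M - u)].
Proof.
move=> al0 A0 L0 L10 /andP[g0 g1] hlo hlo2 hhi hhi2 hr1 hr2 hr3 hr4 gr1 gr2.
move=> /andP[u1 u2] /andP[v1 v2] /andP[M1 M2].
have bm0 := boxcox_gt0 (- (xi + eps)) A0; have bp0 := boxcox_gt0 (- (xi - eps)) A0.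
have Bm0 := boxcox_gt0 (xi + eps) L0; have Bp0 := boxcox_gt0 (xi - eps) L0.
have Bt0 := boxcox_gt0 t L10.
rewrite /excess_ratio.
(* From here on the transforms are opaque reals, and only arithmetic remains. *)
move: (boxcox (- (xi + eps)) A) (boxcox (- (xi - eps)) A) (boxcox (xi + eps) L)
  (boxcox (xi - eps) L) (boxcox t L1) (boxcox t' L2) (boxcox (- xi) ell)
  (boxcox xi r) (boxcox xi (- r)) (boxcox xi (- ell - r)) (boxcox xi (- ell + r))
  hlo hlo2 hhi hhi2 hr1 hr2 hr3 hr4 gr1 gr2 u1 u2 v1 v2 M1 M2 bm0 bp0 Bm0 Bp0 Bt0.
move=> bm bp Bm Bp Bt Bt' D er enr emr epr.
move=> hlo hlo2 hhi hhi2 hr1 hr2 hr3 hr4 gr1 gr2 u1 u2 v1 v2 M1 M2 bm0 bp0 Bm0 Bp0 Bt0.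
have uv1 : al * (D - g) <= u - v.
  apply: (@le_trans _ _ (al * (enr - epr))); first by rewrite ler_pM2l.
  by lra.
have uv2 : u - v <= al * (D + g).
  apply: (@le_trans _ _ (al * (er - emr))); last by rewrite ler_pM2l.
  by lra.
have lo0 : 0 < lo by lra.
have Dg0 : 0 < D - g by nra.
have hMu1 : al * (Bt * (1 - g)) <= M - u.
  apply: (@le_trans _ _ (al * (Bt - er))); last lra.
  by rewrite ler_pM2l//; lra.
(* One g comes from comparing [L2] with [L], the other from the lower bound on u. *)
have hMu2 : M - u <= al * (Bm * (1 + 2 * g)).
  apply: (@le_trans _ _ (al * (Bt' - enr))); first lra.
  by rewrite ler_pM2l//; lra.
have Bg0 : 0 < Bt * (1 - g) by rewrite mulr_gt0// subr_gt0.
split.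
- by rewrite -subr_gt0 (lt_le_trans _ uv1)// mulr_gt0.
- by rewrite -subr_gt0 (lt_le_trans _ hMu1)// mulr_gt0.
apply/andP; split.
  apply: le_trans uv1; apply: (@le_trans _ _ (bm / Bm * (al * (Bm * (1 + 2 * g))))).
    by rewrite ler_pM2l// divr_gt0.
  rewrite [leLHS](_ : _ = al * (bm * (1 + 2 * g))); last by field; rewrite gt_eqF.
  rewrite ler_pM2l//; apply: le_trans hlo2; rewrite ler_pM2r//; lra.
(* The chain is (D + g) Bp <= (D + g) (1 + g) Bt <= hi (1 - g) Bt <= bp (1 - g) Bt. *)
apply: le_trans uv2 _; apply: (@le_trans _ _ (bp / Bp * (al * (Bt * (1 - g))))); last first.
  by rewrite ler_pM2l// divr_gt0.
rewrite [leRHS](_ : _ = al * (bp * (1 - g) * Bt / Bp)); last by field; rewrite gt_eqF.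
rewrite ler_pM2l// ler_pdivlMr//.
have Dg : 0 < D + g by lra.
apply: (@le_trans _ _ ((D + g) * ((1 + g) * Bt))); first by rewrite ler_pM2l.
rewrite mulrA ler_pM2r//; apply: (le_trans hhi2).
by rewrite ler_pM2r// subr_gt0.
Qed.

End Bracket.

(** * Events of eventually small probability *)

Section NearNull.
Context d (T : measurableType d) (R : realType) (P : probability T R).
Implicit Types (A B : nat -> set T).

(** Measurability is bundled in because subadditivity and monotonicity of [P] require it. *)
Definition near_null (e : R) B :=
  \forall n \near \oo, measurable (B n) /\ (P (B n) <= e%:E)%E.

Lemma near_null_le e f B : e <= f -> near_null e B -> near_null f B.
Proof.
move=> ef; apply: filterS => n [mB PB]; split => //.
by apply: le_trans PB _; rewrite lee_fin.
Qed.

Lemma near_nullU e f A B : near_null e A -> near_null f B ->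
  near_null (e + f) (fun n => A n `|` B n).
Proof.
move=> nA nB; near=> n.
have [mA PA] : measurable (A n) /\ (P (A n) <= e%:E)%E by near: n.
have [mB PB] : measurable (B n) /\ (P (B n) <= f%:E)%E by near: n.
split; first exact: measurableU.
by rewrite (le_trans (measureU2 _ mA mB))// EFinD leeD.
Unshelve. all: end_near. Qed.

Lemma near_null_cvg0 B :
  (\forall n \near \oo, measurable (B n)) ->
  (forall e, 0 < e -> exists2 A, near_null e A & \forall n \near \oo, B n `<=` A n) ->
  P (B n) @[n --> \oo] --> 0%E.
Proof.
move=> mB h.
apply/fine_cvgP; split; first by apply: filterS mB => n mBn; exact: fin_num_measure.
apply/cvgrPdist_le => e e0; have [A nA BA] := h e e0; near=> n.
rewrite sub0r normrN ger0_norm ?fine_ge0//.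
have [mA PA] : measurable (A n) /\ (P (A n) <= e%:E)%E by near: n.
have mBn : measurable (B n) by near: n.
have BAn : B n `<=` A n by near: n.
rewrite -lee_fin fineK ?fin_num_measure//; apply: le_trans PA.
by apply: le_measure; rewrite ?inE.
Unshelve. all: end_near. Qed.

End NearNull.

(** * Limits of intermediate and extreme order statistics *)

Section OrderStatLimits.
Context d (T : measurableType d) (R : realType) (P : probability T R).
Variables (X : nat -> {RV P >-> R}) (F : R -> R).
Hypothesis iidX : iid_RVs F X.

Let os k n w := order_stat (fun i => X i w) (n - k + 1) n.

Lemma measurable_os_gt k n y : (0 < k <= n)%N -> measurable [set w | y < os k n w].
Proof.
move=> kn; have := measurable_order_stat X kn measurableT (measurable_itv `]y, +oo[).
by rewrite setTI; congr measurable; apply/funext => w; rewrite /= in_itv/= andbT.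
Qed.

Lemma measurable_os_le k n y : (0 < k <= n)%N -> measurable [set w | os k n w <= y].
Proof.
move=> kn; have := measurable_order_stat X kn measurableT (measurable_itv `]-oo, y]).
by rewrite setTI; congr measurable; apply/funext => w; rewrite /= in_itv.
Qed.

Section Intermediate.
Variables (k : nat -> nat) (y : nat -> R) (v : R).
Hypotheses (kn : \forall n \near \oo, (0 < k n <= n)%N) (ky : k n @[n --> \oo] --> \oo).
Hypothesis yv : n%:R * tail F (y n) / (k n)%:R @[n --> \oo] --> v.

(** Dividing numerator and denominator by k^2 turns Chebyshev's bound into a convergent factor times
    1 / k. *)
Let bound_cvg0 : v != 1 ->
  (n%:R * tail F (y n) / (k n)%:R) / (1 - n%:R * tail F (y n) / (k n)%:R) ^+ 2 / (k n)%:R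
  @[n --> \oo] --> (0 : R).
Proof.
move=> v1; rewrite -[X in _ --> X](mulr0 (v / (1 - v) ^+ 2)); apply: cvgM.
  apply: cvgM => //; apply: cvgV.
    by rewrite expf_neq0// subr_eq0 eq_sym.
  have h : 1 - n%:R * tail F (y n) / (k n)%:R @[n --> \oo] --> 1 - v.
    by apply: cvgB => //; exact: cvg_cst.
  by under eq_fun do rewrite expr2; rewrite expr2; exact: cvgM.
apply/gtr0_cvgV0; last by apply/cvgrnyP.
by near=> n; rewrite ltr0n; near: n; apply: filterS kn => n /andP[].
Unshelve. all: end_near. Qed.

Let boundE n : (0 < k n)%N ->
  n%:R * tail F (y n) / ((k n)%:R - n%:R * tail F (y n)) ^+ 2 =
  (n%:R * tail F (y n) / (k n)%:R) / (1 - n%:R * tail F (y n) / (k n)%:R) ^+ 2 / (k n)%:R.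
Proof.
move=> k0; have k0R : (k n)%:R != 0 :> R by rewrite pnatr_eq0 -lt0n.
have -> : (k n)%:R - n%:R * tail F (y n) =
    (1 - n%:R * tail F (y n) / (k n)%:R) * (k n)%:R by field.
(* If z = 0, both sides are 0 because division by zero yields 0. *)
set z := 1 - _; have [->|z0] := eqVneq z 0.
  by rewrite mul0r !expr0n/= invr0 !(mulr0, mul0r).
by field; rewrite z0 k0R.
Qed.

(** About v k observations exceed [y n]; reaching k of them is a deviation of order k, against a
    standard deviation of order at most sqrt k. *)
Lemma near_null_os_gt e : v < 1 -> 0 < e ->
  near_null P e (fun n => [set w | y n < os (k n) n w]).
Proof.
move=> v1 e0; near=> n.
have kn' : (0 < k n <= n)%N by near: n.
have k0 : (0 < k n)%N by case/andP: kn'.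
split; first exact: measurable_os_gt.
have h : n%:R * tail F (y n) < (k n)%:R.
  rewrite -[ltRHS]mul1r -ltr_pdivrMr ?ltr0n//; near: n.
  exact: cvgr_lt yv _ v1.
apply: le_trans (order_stat_gt_le iidX kn' h) _.
rewrite boundE// lee_fin ltW//; near: n.
by apply: cvgr_lt (bound_cvg0 _) _ e0; rewrite lt_eqF.
Unshelve. all: end_near. Qed.

Lemma near_null_os_le e : 1 < v -> 0 < e ->
  near_null P e (fun n => [set w | os (k n) n w <= y n]).
Proof.
move=> v1 e0; near=> n.
have kn' : (0 < k n <= n)%N by near: n.
have k0 : (0 < k n)%N by case/andP: kn'.
split; first exact: measurable_os_le.
have h : (k n)%:R < n%:R * tail F (y n).
  rewrite -[ltLHS]mul1r -ltr_pdivlMr ?ltr0n//; near: n.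
  exact: cvgr_gt yv _ v1.
apply: le_trans (order_stat_le_le iidX kn' h) _.
rewrite -sqrrN opprB boundE// lee_fin ltW//; near: n.
by apply: cvgr_lt (bound_cvg0 _) _ e0; rewrite gt_eqF.
Unshelve. all: end_near. Qed.

End Intermediate.

(** Chebyshev at rank 1, where z / (1 - z)^2 <= 4 z for z <= 1/2. The rank does not grow, so the
    bound is small only through v. *)
Lemma near_null_max_gt (y : nat -> R) (v : R) : 0 < v <= 2^-1 ->
  (\forall n \near \oo, n%:R * tail F (y n) <= v) ->
  near_null P (4 * v) (fun n => [set w | y n < order_stat (fun i => X i w) n n]).
Proof.
move=> /andP[v0 v1] hv; near=> n.
have n0 : (0 < 1 <= n)%N by rewrite /=; near: n; exact: nbhs_infty_ge.
have h : n%:R * tail F (y n) <= v by near: n.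
have := order_stat_gt_le iidX n0 (y := y n); rewrite subnK//.
move=> /(_ ltac:(lra)) hP; split.
  by have := measurable_os_gt (y n) n0; rewrite /os subnK.
apply: le_trans hP _; rewrite lee_fin.
have t0 : 0 <= n%:R * tail F (y n) by rewrite mulr_ge0// (tail_ge0 iidX).
move: h t0; set z := _ * _ => h t0.
rewrite ler_pdivrMr ?exprn_gt0//; last lra.
have q : 4^-1 <= (1 - z) ^+ 2 by rewrite expr2; nra.
apply: (le_trans h); have := ler_wpM2l (ltW v0) q; lra.
Unshelve. all: end_near. Qed.

(** For z >= 2 one has z <= 2 (z - 1), hence z / (z - 1)^2 <= 4 / z. *)
Lemma near_null_max_le (y : nat -> R) (v : R) : 2 <= v ->
  (\forall n \near \oo, v <= n%:R * tail F (y n)) ->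
  near_null P (4 / v) (fun n => [set w | order_stat (fun i => X i w) n n <= y n]).
Proof.
move=> v2 hv; near=> n.
have n0 : (0 < 1 <= n)%N by rewrite /=; near: n; exact: nbhs_infty_ge.
have h : v <= n%:R * tail F (y n) by near: n.
have := order_stat_le_le iidX n0 (y := y n); rewrite subnK//.
move=> /(_ ltac:(lra)) hP; split.
  by have := measurable_os_le (y n) n0; rewrite /os subnK.
apply: le_trans hP _; rewrite lee_fin.
move: h; set z := _ * _ => h.
rewrite ler_pdivrMr ?exprn_gt0//; last lra.
rewrite mulrAC ler_pdivlMr; last lra.
have q : z ^+ 2 <= 4 * (z - 1) ^+ 2 by rewrite !expr2; nra.
by apply: le_trans q; rewrite expr2 ler_pM2l//; lra.
Unshelve. all: end_near. Qed.

(* A probability is unconstrained on nonmeasurable sets, so convergence in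
   probability requires this. *)
Lemma measurable_xi_hat_dist (k k' n : nat) (theta0 xi eps : R) :
  (1 < k')%N -> (k' < k)%N -> (k < n)%N ->
  measurable [set w | eps < `|xi_hat theta0 k k' n (fun i => X i w) - xi|].
Proof.
move=> k'1 k'k kn.
have k'n : (k' < n)%N by exact: ltn_trans kn.
have k0' : (0 < k' <= n)%N by rewrite (ltnW k'1) (ltnW k'n).
have k0 : (0 < k <= n)%N by rewrite (ltnW kn) (leq_trans _ k'k).
have n1 : (0 < 1 <= n)%N by rewrite (leq_trans _ k'n).
pose v := os k n; pose u := os k' n; pose M w := order_stat (fun i => X i w) n n.
have mv : measurable_fun [set: T] v by exact: measurable_order_stat.
have mu : measurable_fun [set: T] u by exact: measurable_order_stat.
have mM : measurable_fun [set: T] M.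
  by have := measurable_order_stat X n1; rewrite subnK.
have vu w : v w <= u w.
  apply: order_stat_le; rewrite ?addn1// ltnS leq_sub2l ?(ltnW k'k)//=.
  by rewrite ltn_subrL (ltnW k'1).
have uM w : u w <= M w.
  by apply: order_stat_le; rewrite ?addn1// leqnn andbT ltn_subrL (ltnW k'1).
have lt_set f g : measurable_fun [set: T] f -> measurable_fun [set: T] g ->
    measurable [set w | f w < g w :> R].
  move=> mf mg; have := measurable_fun_ltr mf mg measurableT (Y := [set true]) I.
  by rewrite setTI.
pose Qp := excess_ratio (ln (k%:R / k'%:R)) (ln k'%:R) (xi + eps).
pose Qm := excess_ratio (ln (k%:R / k'%:R)) (ln k'%:R) (xi - eps).
(* Where v < u < M, [xi_hat_dist] describes the event by inequalities between order statistics;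
   elsewhere the estimator is the constant [theta0]. *)
have -> : [set w | eps < `|xi_hat theta0 k k' n (fun i => X i w) - xi|] =
  ([set w | v w < u w] `&` [set w | u w < M w] `&`
    ([set w | u w - v w < Qp * (M w - u w)] `|`
     [set w | Qm * (M w - u w) < u w - v w])) `|`
  (~` ([set w | v w < u w] `&` [set w | u w < M w]) `&`
   [set w | eps < `|theta0 - xi|]).
  apply/funext => w; apply/propext; rewrite /setU/setI/setC/=.
  have [/andP[W1 W2]|W] := boolP (v w < u w < M w).
    have W : v w < u w < M w by rewrite W1.
    rewrite !ltNge (xi_hat_dist k'1 k'k theta0 xi eps W).
    rewrite negb_and -!ltNge W1 W2; split.
      by move=> /orP[] h; left; split => //; [left|right].
    by move=> [[_ []->//]|[]]; rewrite ?orbT//; case.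
  have W' : ~ (v w < u w < M w) by apply/negP.
  rewrite (xi_hat_default k'1 k'k theta0 (vu w) (uM w) W'); split.
    by move=> h; right; split => // -[h1 h2]; apply: W'; rewrite h1.
  by move=> [[[h1 h2]]|[]//]; case: W'; rewrite h1.
apply: measurableU; apply: measurableI.
- by apply: measurableI; exact: lt_set.
- apply: measurableU; apply: lt_set.
  + exact: measurable_funB.
  + by apply: measurable_funM; [exact: measurable_cst|exact: measurable_funB].
  + by apply: measurable_funM; [exact: measurable_cst|exact: measurable_funB].
  + exact: measurable_funB.
- by apply: measurableC; apply: measurableI; exact: lt_set.
- by apply: lt_set; exact: measurable_cst.
Qed.

End OrderStatLimits.

(** * Asymptotics of ranks, block sizes and dyadic scales *)

Section Ranks.
Context {R : realType}.
Variables (k k' : nat -> nat) (c : R).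
Hypothesis hk : \forall n \near \oo, (1 < k' n)%N /\ (k' n < k n)%N /\ (k n < n)%N.
Hypothesis kc : (k n)%:R / (k' n)%:R @[n --> \oo] --> c.
Hypothesis c1 : 1 < c.
Hypothesis koo : k n @[n --> \oo] --> \oo.
Hypothesis kn0 : (k n)%:R / n%:R @[n --> \oo] --> (0 : R).

Let m n := (n %/ k' n)%N.

Lemma rank_cvgy : k' n @[n --> \oo] --> \oo.
Proof.
apply/cvgnyPge => A; have [B hB] : exists B : nat, (c + 1) * A%:R <= B%:R.
  by near \oo => B; exists B; near: B; exact: nbhs_infty_ger.
near=> n.
have [k'1 _] : (1 < k' n)%N /\ (k' n < k n)%N /\ (k n < n)%N by near: n.
have p0 : (0 : R) < (k' n)%:R by rewrite ltr0n ltnW.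
have h1 : (k n)%:R < (c + 1) * (k' n)%:R.
  by rewrite -ltr_pdivrMr//; near: n; apply: cvgr_lt kc _ _; rewrite ltrDl.
have h2 : (B <= k n)%N by near: n; move/cvgnyPge : koo; exact.
rewrite -(@ler_nat R) -(@ler_pM2l _ (c + 1)); last by rewrite addr_gt0// (lt_trans _ c1).
by rewrite (le_trans hB)// (le_trans _ (ltW h1))// ler_nat.
Unshelve. all: end_near. Qed.

Lemma block_cvgy : m n @[n --> \oo] --> \oo.
Proof.
apply/cvgnyPge => A; near=> n.
have [k'1 [k'k kn]] : (1 < k' n)%N /\ (k' n < k n)%N /\ (k n < n)%N by near: n.
rewrite /m leq_divRL ?(ltnW k'1)//.
have n0 : (0 : R) < n%:R by rewrite ltr0n (leq_trans _ kn).
have h : (k n)%:R / n%:R < A.+1%:R^-1 :> R.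
  by near: n; apply: cvgr_lt kn0 _ _; rewrite invr_gt0 ltr0n.
rewrite ltr_pdivrMr// mulrC ltr_pdivlMr ?ltr0n// -natrM ltr_nat in h.
apply: ltnW; apply: leq_ltn_trans h.
by rewrite mulnC leq_mul// ltnW.
Unshelve. all: end_near. Qed.

(** Since m k' <= n < (m + 1) k', the ratio lies between 1 and 1 + 1 / m. *)
Lemma block_ratio_cvg1 : n%:R / ((m n)%:R * (k' n)%:R) @[n --> \oo] --> (1 : R).
Proof.
have up : 1 + (m n)%:R^-1 @[n --> \oo] --> (1 : R).
  rewrite -[X in _ --> X]addr0; apply: cvgD; first exact: cvg_cst.
  apply/gtr0_cvgV0; last by apply/cvgrnyP; exact: block_cvgy.
  by near=> n; rewrite ltr0n; near: n; move/cvgnyPgt : block_cvgy; exact.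
apply: squeeze_cvgr (cvg_cst _) up; near=> n.
have [k'1 _] : (1 < k' n)%N /\ (k' n < k n)%N /\ (k n < n)%N by near: n.
have p0 : (0 : R) < (k' n)%:R by rewrite ltr0n ltnW.
have m0 : (0 : R) < (m n)%:R.
  by rewrite ltr0n; near: n; move/cvgnyPgt : block_cvgy; exact.
apply/andP; split.
  by rewrite ler_pdivlMr ?mulr_gt0// mul1r -natrM ler_nat leq_trunc_div.
rewrite ler_pdivrMr ?mulr_gt0// mulrA mulrDl mul1r mulVf ?gt_eqF//.
rewrite natr1 -natrM ler_nat ltnW//.
by rewrite -ltn_divLR ?(ltnW k'1).
Unshelve. all: end_near. Qed.

(** Passes from block size m to sample size n: n is asymptotic to m k', and k to c k'. *)
Lemma rank_tail_cvg (p : nat -> R) (v : R) : (m n)%:R * p n @[n --> \oo] --> v ->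
  n%:R * p n / (k' n)%:R @[n --> \oo] --> v /\ n%:R * p n / (k n)%:R @[n --> \oo] --> v / c.
Proof.
move=> hv; have h' : n%:R * p n / (k' n)%:R @[n --> \oo] --> v.
  rewrite -[X in _ --> X]mul1r; apply: cvg_trans (cvgM block_ratio_cvg1 hv).
  apply: near_eq_cvg; near=> n.
  have [k'1 _] : (1 < k' n)%N /\ (k' n < k n)%N /\ (k n < n)%N by near: n.
  have p0 : (k' n)%:R != 0 :> R by rewrite pnatr_eq0 -lt0n ltnW.
  have m0 : (m n)%:R != 0 :> R.
    by rewrite pnatr_eq0 -lt0n; near: n; move/cvgnyPgt : block_cvgy; exact.
  by rewrite /=; field; rewrite p0 m0.
split => //.
apply: cvg_trans (cvgM h' (cvgV (lt0r_neq0 (lt_trans ltr01 c1)) kc)).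
apply: near_eq_cvg; near=> n.
have [k'1 [k'k _]] : (1 < k' n)%N /\ (k' n < k n)%N /\ (k n < n)%N by near: n.
have p0 : (k' n)%:R != 0 :> R by rewrite pnatr_eq0 -lt0n ltnW.
have p0' : (k n)%:R != 0 :> R by rewrite pnatr_eq0 -lt0n (leq_trans _ k'k).
by rewrite /=; field; rewrite p0 p0'.
Unshelve. all: end_near. Qed.

Let j n := trunc_log 2 (k' n).

Lemma scale_cvgy : j n @[n --> \oo] --> \oo.
Proof.
apply/cvgnyPge => A; near=> n; apply: trunc_log_max => //.
by near: n; move/cvgnyPge : rank_cvgy; exact.
Unshelve. all: end_near. Qed.

(** Rounding n / k' down to m and k' down to 2^j loses at most a factor 2 each. *)
Lemma block_scale_bounds : \forall n \near \oo,
  (2 ^ j n * m n <= n)%N /\ (n <= 4 * (2 ^ j n * m n))%N.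
Proof.
near=> n.
have [k'1 _] : (1 < k' n)%N /\ (k' n < k n)%N /\ (k n < n)%N by near: n.
have m0 : (0 < m n)%N by near: n; move/cvgnyPgt : block_cvgy; exact.
have j1 : (2 ^ j n <= k' n)%N by rewrite trunc_logP// ltnW.
have j2 : (k' n <= 2 ^ (j n).+1)%N by rewrite ltnW// trunc_log_ltn.
split.
  by rewrite (leq_trans _ (leq_trunc_div n (k' n)))// mulnC leq_mul2l j1 orbT.
apply: (@leq_trans ((m n).+1 * k' n)).
  by rewrite ltnW// -ltn_divLR ?(ltnW k'1).
have -> : (4 * (2 ^ j n * m n) = (2 * m n) * 2 ^ (j n).+1)%N.
  by rewrite expnS -[4%N]/(2 * 2)%N [in RHS]mulnACA; congr muln; rewrite mulnC.
by rewrite leq_mul// mul2n -addnn -addn1 leq_add2l.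
Unshelve. all: end_near. Qed.

Lemma ln_rank_bounds : \forall n \near \oo,
  (j n)%:R * ln 2 <= ln ((k' n)%:R : R) <= (j n)%:R * ln 2 + ln 2.
Proof.
near=> n.
have [k'1 _] : (1 < k' n)%N /\ (k' n < k n)%N /\ (k n < n)%N by near: n.
have p0 : (0 : R) < (k' n)%:R by rewrite ltr0n ltnW.
have lnX i : i%:R * ln 2 = ln (2 ^ i)%:R :> R by rewrite natrX lnXn// mulr_natl.
rewrite -[X in _ <= _ + X]mul1r -mulrDl natr1 !lnX !ler_ln ?posrE ?ltr0n ?expn_gt0 ?(ltnW k'1)//.
by rewrite !ler_nat trunc_logP ?(ltnW k'1)//= ltnW// trunc_log_ltn.
Unshelve. all: end_near. Qed.

Lemma ln_rank_cvgy : ln ((k' n)%:R : R) @[n --> \oo] --> +oo.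
Proof.
have /cvgrnyP/cvgryPge h := rank_cvgy.
apply/cvgryPge => A; have {}h := h R (expR A); near=> n.
rewrite -[A]expRK ler_ln ?posrE ?expR_gt0//; last first.
  by rewrite ltr0n; near: n; move/cvgnyPgt : rank_cvgy; exact.
by near: n.
Unshelve. all: end_near. Qed.

End Ranks.

(** * Consistency from six exceptional events *)

Theorem theorem1 (R : realType) (d : measure_display) (T : measurableType d)
  (P : probability T R) (X : nat -> {RV P >-> R}) (F : R -> R)
  (xi : R) (a b : nat -> R) (k k' : nat -> nat) (c theta0 : R) :
  iid_RVs F X ->
  (forall n, 0 < a n) ->
  (forall x : R,
     P [set w | (sample_max (fun i => X i w) n - b n) / a n <= x]
       @[n --> \oo] --> (gev xi x)%:E) ->
  (\forall n \near \oo, (1 < k' n)%N /\ (k' n < k n)%N /\ (k n < n)%N) ->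
  (k n)%:R / (k' n)%:R @[n --> \oo] --> c ->
  1 < c ->
  k n @[n --> \oo] --> \oo ->
  (k n)%:R / n%:R @[n --> \oo] --> (0 : R) ->
  cvg_in_probability P
    (fun n w => xi_hat theta0 (k n) (k' n) n (fun i => X i w)) xi.
Proof.
move=> iidX a0 HG hk kc c1 koo kn0 eps eps0.
have F01 := cdf01 iidX.
have Fmono : {homo F : x y / x <= y}.
  by move=> x y /(tail_le iidX); rewrite /tail lerD2l lerN2.
have FG x : F (a n * x + b n) ^+ n @[n --> \oo] --> gev xi x.
  have /fine_cvgP[_ h] := HG x; apply: cvg_trans h; apply: near_eq_cvg.
  near=> n; have n0 : (0 < n)%N by near: n; exact: nbhs_infty_gt.
  rewrite /= -(prednK n0) (_ : mkset _ = [set w | sample_max (fun i => X i w) n.-1.+1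
      <= a n.-1.+1 * x + b n.-1.+1]); first by rewrite (sample_max_cdf iidX).
  by apply/funext => w /=; rewrite ler_pdivrMr// lerBlDr mulrC.
pose m n := (n %/ k' n)%N; pose j n := trunc_log 2 (k' n).
have moo : m n @[n --> \oo] --> \oo := block_cvgy hk kn0.
have joo : j n @[n --> \oo] --> \oo := scale_cvgy hk kc c1 koo.
have Loo : ln ((k' n)%:R : R) @[n --> \oo] --> +oo := ln_rank_cvgy hk kc c1 koo.
pose ell := ln c; have ell0 : 0 < ell by rewrite ln_gt0.
have c0 : 0 < c by exact: lt_trans c1.
have [g [lo [hi [[g01 /andP[lo1 lo2] lo3] [hi1 hi2]]]]] := bracket_constants xi eps0 ell0.
(* Halfway values leave room on both sides: t < xi < t' for [attraction_potter], xi - eps < t and t'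
   < xi + eps for [boxcox_growth]. *)
pose t := xi - eps / 2; pose t' := xi + eps / 2.
have txi : t < xi by rewrite /t; lra.
have xit' : xi < t' by rewrite /t'; lra.
have g0 : 0 < g by case/andP: g01.
(* Values at 1 make [del] independent of n; they are lower bounds once [L n] and [L1 n] are at least
   1. *)
pose del := Num.min (g * boxcox (xi + eps) 1) (g * boxcox t 1).
have del0 : 0 < del by rewrite lt_min !mulr_gt0// boxcox_gt0.
have [r r0 [r1 r2 r3 r4]] := bracket_radius xi ell g0 del0.
pose y s n := a (m n) * boxcox xi s + b (m n).
have ycvg s : (m n)%:R * tail F (y s n) @[n --> \oo] --> expR (- s).
  have h := attraction_tail F01 FG (s := s).
  exact: (cvg_comp _ _ moo h).
have yk' s : n%:R * tail F (y s n) / (k' n)%:R @[n --> \oo] --> expR (- s).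
  by have [] := rank_tail_cvg hk kc c1 kn0 (ycvg s).
(* Replacing k' by k divides the limit by c = e^{ell}, which shifts the exponent by ell. *)
have yk s : n%:R * tail F (y s n) / (k n)%:R @[n --> \oo] --> expR (- s - ell).
  by rewrite expRB lnK ?posrE//; have [] := rank_tail_cvg hk kc c1 kn0 (ycvg s).
have kpos : \forall n \near \oo, (0 < k n <= n)%N.
  by apply: filterS hk => n [_ [k'k /ltnW ->]]; rewrite andbT (leq_trans _ k'k).
have kpos' : \forall n \near \oo, (0 < k' n <= n)%N.
  apply: filterS hk => n [k'1 [k'k kn]].
  by rewrite (ltnW k'1) ltnW// (ltn_trans k'k).
have k'oo := rank_cvgy hk kc c1 koo.
apply: near_null_cvg0.
  apply: filterS hk => n [k'1 [k'k kn]].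
  exact: measurable_xi_hat_dist.
move=> e e0.
(* The bound 16 ensures 2 <= v1 and v2 <= 1/2. The bound 192 / e makes 4 / v1 at most e / 24 and 4
   v2 at most e / 6, which together with four events at e / 6 stays below e. *)
have [J J16 Je] : exists2 J : nat, 16 <= (2 ^ J)%:R :> R & 192 / e <= (2 ^ J)%:R.
  have [J hJ] : exists J : nat, Num.max 16 (192 / e) <= J%:R.
    by near \oo => J; exists J; near: J; exact: nbhs_infty_ger.
  have h : J%:R <= (2 ^ J)%:R :> R by rewrite ler_nat ltnW// ltn_expl.
  by exists J; apply: le_trans h; apply: le_trans hJ; rewrite le_max lexx ?orbT.
have J0 : 0 < (2 ^ J)%:R :> R by apply: lt_le_trans J16.
pose v2 : R := 8 / (2 ^ J)%:R; pose v1 : R := (2 ^ J)%:R / 2.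
(* As 2^j m equals n up to a factor 4, these are the locations for about n / 2^J and 2^J n
   observations. *)
pose y1 n := b (2 ^ (j n - J) * m n)%N; pose y2 n := b (2 ^ (j n + J) * m n)%N.
have bt : n%:R * tail F (b n) @[n --> \oo] --> (1 : R).
  have := attraction_tail F01 FG (s := 0); rewrite oppr0 expR0 boxcox0.
  by under eq_fun do rewrite mulr0 add0r.
(* Each location is exceeded about once on average by a sample of its own size; the factor 2 of
   slack enters [v1] and [v2]. *)
have [N0 _ hN0] : \forall n \near \oo, 2^-1 <= n%:R * tail F (b n) <= 2.
  near=> n; apply/andP; split; apply: ltW; near: n.
    by apply: cvgr_gt bt _ _; lra.
  by apply: cvgr_lt bt _ _; lra.
have mN i n : (N0 <= m n)%N -> (N0 <= 2 ^ i * m n)%N.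
  by move=> h; rewrite (leq_trans h)// leq_pmull// expn_gt0.
have hy1 : \forall n \near \oo, v1 <= n%:R * tail F (y1 n).
  near=> n.
  have [h _] : (2 ^ j n * m n <= n)%N /\ (n <= 4 * (2 ^ j n * m n))%N.
    by near: n; exact: (block_scale_bounds hk kn0).
  have jJ : (J <= j n)%N by near: n; move/cvgnyPge : joo; exact.
  have mN0 : (N0 <= m n)%N by near: n; move/cvgnyPge : moo; exact.
  have /andP[h1 _] := hN0 _ (mN (j n - J)%N n mN0).
  have h2 : (2 ^ J)%:R * (2 ^ (j n - J) * m n)%N%:R <= n%:R :> R.
    by rewrite -natrM ler_nat mulnA -expnD subnKC.
  apply: le_trans (ler_wpM2r (tail_ge0 iidX _) h2).
  by rewrite -mulrA /v1 ler_pM2l.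
have hy2 : \forall n \near \oo, n%:R * tail F (y2 n) <= v2.
  near=> n.
  have [_ h] : (2 ^ j n * m n <= n)%N /\ (n <= 4 * (2 ^ j n * m n))%N.
    by near: n; exact: (block_scale_bounds hk kn0).
  have mN0 : (N0 <= m n)%N by near: n; move/cvgnyPge : moo; exact.
  have /andP[_ h1] := hN0 _ (mN (j n + J)%N n mN0).
  have h2 : n%:R * (2 ^ J)%:R <= 4 * (2 ^ (j n + J) * m n)%N%:R :> R.
    by rewrite -!natrM ler_nat expnD mulnAC mulnA leq_mul2r h orbT.
  rewrite /v2 ler_pdivlMr// mulrAC.
  apply: le_trans (ler_wpM2r (tail_ge0 iidX _) h2) _.
  by rewrite -mulrA; move: h1; rewrite /y2; lra.
have e6 : 0 < e / 6 by rewrite divr_gt0.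
have exr0 : 1 < expR r by rewrite expR_gt1.
have exr1 : expR (- r) < 1 by rewrite expR_lt1 oppr_lt0.
have B1 : near_null P (e / 6) (fun n => [set w |
    order_stat (fun i => X i w) (n - k' n + 1) n <= y (- r) n]).
  by apply: (near_null_os_le iidX kpos' k'oo (yk' (- r))) => //; rewrite opprK.
have B2 : near_null P (e / 6) (fun n => [set w |
    y r n < order_stat (fun i => X i w) (n - k' n + 1) n]).
  exact: (near_null_os_gt iidX kpos' k'oo (yk' r)).
have B3 : near_null P (e / 6) (fun n => [set w |
    order_stat (fun i => X i w) (n - k n + 1) n <= y (- ell - r) n]).
  apply: (near_null_os_le iidX kpos koo (yk (- ell - r))) => //.
  by rewrite (_ : - (- ell - r) - ell = r)//; ring.
have B4 : near_null P (e / 6) (fun n => [set w |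
    y (- ell + r) n < order_stat (fun i => X i w) (n - k n + 1) n]).
  apply: (near_null_os_gt iidX kpos koo (yk (- ell + r))) => //.
  by rewrite (_ : - (- ell + r) - ell = - r)//; ring.
have B5 : near_null P (4 / v1) (fun n => [set w |
    order_stat (fun i => X i w) n n <= y1 n]).
  by apply: (near_null_max_le iidX) hy1; rewrite /v1; lra.
have B6 : near_null P (4 * v2) (fun n => [set w |
    y2 n < order_stat (fun i => X i w) n n]).
  apply: (near_null_max_gt iidX) hy2; rewrite /v2 divr_gt0//=.
  by rewrite ler_pdivrMr//; lra.
eexists.
  apply: near_null_le (near_nullU (near_nullU (near_nullU B1 B2) (near_nullU B3 B4))
    (near_nullU B5 B6)).
  have ee : 192 / (2 ^ J)%:R <= e.
    by rewrite ler_pdivrMr// mulrC -ler_pdivrMr.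
  have -> : 4 / v1 = 192 / (2 ^ J)%:R / 24 by rewrite /v1; field; rewrite gt_eqF.
  have -> : 4 * v2 = 192 / (2 ^ J)%:R / 6 by rewrite /v2; field; rewrite gt_eqF.
  by move: ee; set z := 192 / _ => ee; lra.
(* ln k' lies between j ln 2 and (j + 1) ln 2, so it differs from (j - J) ln 2 and (j + J) ln 2 by
   at most [C]. *)
pose C := J.+1%:R * ln 2 : R.
have L2 : 0 < ln 2 :> R by rewrite ln_gt0// ltr1n.
have growth1 : \forall L \near +oo, boxcox (xi - eps) (L + C) <= (1 + g) * boxcox t L.
  by apply: boxcox_growth => //; rewrite /t; lra.
have growth2 : \forall L \near +oo, boxcox t' (L + C) <= (1 + g) * boxcox (xi + eps) L.
  by apply: boxcox_growth => //; rewrite /t'; lra.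
pose A n := ln ((k n)%:R / (k' n)%:R) : R.
(* The strict inequalities [lo1] and [hi1] at ell therefore persist at [A n] for large n. *)
have Acvg : A n @[n --> \oo] --> ell.
  by apply: continuous_cvg kc; exact: continuous_ln.
have Abox s : boxcox s (A n) @[n --> \oo] --> boxcox s ell.
  by apply: continuous_cvg Acvg; exact: continuous_boxcox.
pose L n := ln ((k' n)%:R : R); pose L1 n := (j n - J)%N%:R * ln 2 : R.
pose Lj n := (j n + J)%N%:R * ln 2 : R.
have LL1 : \forall n \near \oo, L n - C <= L1 n /\ Lj n <= L n + C.
  near=> n.
  have jJ : (J <= j n)%N by near: n; move/cvgnyPge : joo; exact.
  have /andP[h1 h2] : (j n)%:R * ln 2 <= L n <= (j n)%:R * ln 2 + ln 2.
    by near: n; exact: (ln_rank_bounds hk).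
  rewrite /L1 /Lj /C natrB// natrD -[J.+1%:R]natr1 !mulrDl mul1r mulNr.
  by split; lra.
have L1oo : L1 n @[n --> \oo] --> +oo.
  apply/cvgryPge => M; near=> n.
  have [h _] : L n - C <= L1 n /\ Lj n <= L n + C by near: n.
  apply: le_trans h; rewrite lerBrDr; near: n.
  by move/cvgryPge : Loo; exact.
have gr1 : \forall n \near \oo, boxcox (xi - eps) (L1 n + C) <= (1 + g) * boxcox t (L1 n).
  exact: L1oo growth1.
have gr2 : \forall n \near \oo, boxcox t' (L n + C) <= (1 + g) * boxcox (xi + eps) (L n).
  exact: Loo growth2.
have inc s (u v : R) : u <= v -> boxcox s u <= boxcox s v.
  by rewrite le_eqVlt => /predU1P[->//|/(boxcox_inc s)/ltW].
have pot : \forall n \near \oo, forall i,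
    a (m n) * boxcox t (i%:R * ln 2) <= b (2 ^ i * m n)%N - b (m n)
      <= a (m n) * boxcox t' (i%:R * ln 2).
  exact: moo (attraction_potter F01 Fmono a0 FG txi xit').
near=> n => w /= hw.
have [k'1 [k'k kn]] : (1 < k' n)%N /\ (k' n < k n)%N /\ (k n < n)%N by near: n.
have [LL1n LjLn] : L n - C <= L1 n /\ Lj n <= L n + C by near: n.
have L1n : 1 <= L1 n by near: n; move/cvgryPge : L1oo; exact.
have Ln : 1 <= L n by near: n; move/cvgryPge : Loo; exact.
(* Outside the six events all inputs of [bracket_excess_ratio] are available, and its conclusion
   contradicts [hw]. *)
apply: contrapT => /not_orP[/not_orP[/not_orP[/negP h1 /negP h2]
  /not_orP[/negP h3 /negP h4]] /not_orP[/negP h5 /negP h6]].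
rewrite -!ltNge in h1 h3 h5; rewrite -!leNgt in h2 h4 h6.
have potter : forall i, a (m n) * boxcox t (i%:R * ln 2) <= b (2 ^ i * m n)%N - b (m n)
    <= a (m n) * boxcox t' (i%:R * ln 2).
  by near: n.
have /andP[p1 _] := potter (j n - J)%N; have /andP[_ p2] := potter (j n + J)%N.
have p0 : (0 : R) < (k' n)%:R by rewrite ltr0n ltnW.
have A0 : 0 < A n by rewrite ln_gt0// ltr_pdivlMr// mul1r ltr_nat.
have L0 : 0 < L n by exact: lt_le_trans Ln.
have L10 : 0 < L1 n by exact: lt_le_trans L1n.
have [] := @bracket_excess_ratio R xi eps ell (A n) (L n) (L1 n) (Lj n) t t' g lo hi r
  (a (m n)) (b (m n)) (order_stat (fun i => X i w) (n - k' n + 1) n)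
  (order_stat (fun i => X i w) (n - k n + 1) n) (order_stat (fun i => X i w) n n)
  (a0 _) A0 L0 L10 g01 _ lo3 _ hi2 r1 r2.
- by apply: ltW; near: n; exact: cvgr_lt (Abox _) _ lo1.
- by apply: ltW; near: n; exact: cvgr_gt (Abox _) _ hi1.
- apply: le_trans r3; rewrite lerN2 (@le_trans _ _ (g * boxcox (xi + eps) 1))//.
    by rewrite ge_min lexx.
  by rewrite ler_pM2l// inc.
- apply: (le_trans r4); rewrite (@le_trans _ _ (g * boxcox t 1))//.
    by rewrite ge_min lexx orbT.
  by rewrite ler_pM2l// inc.
- apply: (@le_trans _ _ (boxcox (xi - eps) (L1 n + C))); last by near: n.
  by apply: inc; rewrite -lerBlDr.
- by apply: (@le_trans _ _ (boxcox t' (L n + C))); [exact: inc|near: n].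
- by rewrite addrC h1 addrC h2.
- by rewrite addrC h3 addrC h4.
- apply/andP; split.
    by apply: le_lt_trans h5; rewrite /y1 addrC -lerBrDr.
  by apply: (le_trans h6); rewrite /y2 addrC -lerBlDr.
move=> vu uM; rewrite -(xi_hat_dist k'1 k'k theta0); last by rewrite vu uM.
by rewrite leNgt hw.
Unshelve. all: end_near. Qed.
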